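(* Let $(\Omega,d,\mu)$ be a doubling metric measure space. Let $X$ be an r.i. space on $\Omega$ and $0<\alpha\le1$. Then for all $f\in L^\alpha(\Omega)+L^\infty(\Omega)$ and $t>0$, $$E_{X^{(\alpha)}}(f,t)\preceq K(f,t;X^{(\alpha)},\dot M^{1,X^{(\alpha)}})\preceq\left(\sum_{j=0}^\infty2^{-j\alpha}E_{X^{(\alpha)}}(f,2^jt)^\alpha\right)^{1/\alpha}$$ and $$K(f,t;X^{(\alpha)},M^{1,X^{(\alpha)}})\simeq K(f,t;X^{(\alpha)},\dot M^{1,X^{(\alpha)}})+\min(1,t)\,\|f\|_{X^{(\alpha)}}.$$
   Context: $A\preceq B$ means $A\le cB$ for a constant $c>0$ independent of $f$ and $t$; $A\simeq B$ means $A\preceq B$ and $B\preceq A$. Doubling metric measure space: $(\Omega,d)$ is a metric space, $B(x,r)=\{y\in\Omega: d(x,y)<r\}$, and $\mu$ is a Borel measure with $0<\mu(B)<\infty$ for every ball $B$, such that for some $C>1$ one has $\mu(B(x,2r))\le C\mu(B(x,r))$ for all $x\in\Omega$, $r>0$. Standing assumptions: $\mu(\Omega)=\infty$ and $\mu(\{x\})=0$ for all $x\in\Omega$. For measurable $f$, $f^*(t)=\inf\{\sigma\ge0:\mu\{|f|>\sigma\}\le t\}$ is the decreasing rearrangement. An r.i. space $X$ on $\Omega$ is a subspace of $L^0(\Omega)$ (measurable functions with the topology of local convergence in measure) with a norm $\|\cdot\|_X$ such that: $X$ is complete; $X\hookrightarrow L^0$ is continuous; $\chi_E\in X$ whenever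 $\mu(E)<\infty$; if $0\le f_n\nearrow f$ a.e. and $f\in X$ then $\|f_n\|_X\nearrow\|f\|_X$; and $\|f\|_X=\|g\|_X$ whenever $f^*=g^*$. For $0<\alpha\le 1$, $X^{(\alpha)}=\{f:|f|^\alpha\in X\}$ with quasi-norm $\|f\|_{X^{(\alpha)}}=\||f|^\alpha\|_X^{1/\alpha}$. Modulus of smoothness: $\nabla_r^\alpha f(x)=\left(\frac1{\mu(B(x,r))}\int_{B(x,r)}|f(x)-f(y)|^\alpha d\mu(y)\right)^{1/\alpha}$ and $E_{X^{(\alpha)}}(f,r)=\|\nabla_r^\alpha f\|_{X^{(\alpha)}}$, $r>0$. Hajłasz–Sobolev spaces: $D(f)$ is the set of nonnegative measurable $g$ with $|f(x)-f(y)|\le d(x,y)(g(x)+g(y))$ for $\mu$-a.e. $x,y\in\Omega$. $\dot M^{1,X^{(\alpha)}}$ consists of the measurable $f\in L^\alpha+L^\infty$ with $\|f\|_{\dot M^{1,X^{(\alpha)}}}=\inf_{g\in D(f)}\|g\|_{X^{(\alpha)}}<\infty$, and $M^{1,X^{(\alpha)}}=\dot M^{1,X^{(\alpha)}}\cap X^{(\alpha)}$ with $\|f\|_{M^{1,X^{(\alpha)}}}=\|f\|_{X^{(\alpha)}}+\|f\|_{\dot M^{1,X^{(\alpha)}}}$. $K$-functional: $K(f,t;X_0,X_1)=\inf_{f=f_0+f_1}\{\|f_0\|_{X_0}+t\|f_1\|_{X_1}\}$ (equal to $+\infty$ if no such decomposition exists).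
   Formalization: The first inequality E ≼ K is asserted only when ∇_t^α f belongs to X^(α) or X is closed under submajorization (as all maximal or minimal r.i. spaces are); without this, with norm +∞ off the space, it fails for some closed r.i. ideals of Marcinkiewicz spaces on R. *)

(* Defs.v *)
From HB Require Import structures.
From mathcomp Require Import all_boot all_order all_algebra.
From mathcomp Require Import all_classical all_reals all_analysis.
Set Implicit Arguments.
Unset Strict Implicit.
Unset Printing Implicit Defensive.
Import Order.TTheory GRing.Theory Num.Theory.
Import numFieldNormedType.Exports.
Local Open Scope classical_set_scope.
Local Open Scope ring_scope.

(* Elements of L^0 are represented by
   everywhere defined real-valued measurable functions; everything below is
   insensitive to modifications on null sets. A (quasi-)normed function space
   is handled through its norm extended by +oo outside the space. *)

Section rearrangement_invariant.
Context {d : measure_display} {T : measurableType d} {R : realType}.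
Variable mu : {measure set T -> \bar R}.

Definition rearr (f : T -> R) (t : R) : \bar R :=
  ereal_inf [set s%:E | s in
    [set s : R | 0 <= s /\ (mu [set x | (s < `|f x|)%R] <= t%:E)%E]].

Definition ext_norm (X : set (T -> R)) (N : (T -> R) -> R) (f : T -> R)
  : \bar R := if `[< X f >] then (N f)%:E else +oo%E.

(* ri_cont is the continuity of the inclusion in L^0, with convergence in
   measure on each set of finite measure. In ri_mono and ri_rearr the norms are
   extended by +oo, so these axioms include the membership statements; in
   particular ri_mono makes X an ideal and ri_rearr makes it closed under a.e.
   equality. *)
Record ri_space := RISpace {
  ri_set : set (T -> R) ;
  ri_norm : (T -> R) -> R ;
  ri_meas : forall f, ri_set f -> measurable_fun [set: T] f ;
  ri_set0 : ri_set (cst 0) ;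
  ri_setD : forall f g, ri_set f -> ri_set g -> ri_set (f \+ g) ;
  ri_setZ : forall (c : R) f, ri_set f -> ri_set (fun x => c * f x) ;
  ri_norm_ge0 : forall f, ri_set f -> 0 <= ri_norm f ;
  ri_norm_eq0 : forall f, ri_set f ->
    (ri_norm f = 0 <-> {ae mu, forall x, f x = 0}) ;
  ri_normD : forall f g, ri_set f -> ri_set g ->
    ri_norm (f \+ g) <= ri_norm f + ri_norm g ;
  ri_normZ : forall (c : R) f, ri_set f ->
    ri_norm (fun x => c * f x) = `|c| * ri_norm f ;
  ri_complete : forall u : nat -> T -> R, (forall n, ri_set (u n)) ->
    (forall e : R, 0 < e -> exists n0 : nat, forall m n : nat,
      (n0 <= m)%N -> (n0 <= n)%N -> ri_norm (u m \- u n) < e) ->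
    exists2 f, ri_set f & ri_norm (u n \- f) @[n --> \oo] --> (0 : R) ;
  ri_cont : forall f, ri_set f ->
    forall E, measurable E -> (mu E < +oo)%E ->
    forall e eta : R, 0 < e -> 0 < eta ->
    exists2 delta : R, 0 < delta & forall g, ri_set g ->
      ri_norm (g \- f) < delta ->
      (mu (E `&` [set x | (e < `|g x - f x|)%R]) < eta%:E)%E ;
  ri_indic : forall E, measurable E -> (mu E < +oo)%E -> ri_set \1_E ;
  ri_mono : forall (f_ : nat -> T -> R) f,
    (forall n, measurable_fun [set: T] (f_ n)) ->
    {ae mu, forall x, [/\ forall n, 0 <= f_ n x,
       nondecreasing_seq (fun n => f_ n x) & f_ n x @[n --> \oo] --> f x]} ->
    ri_set f ->
    nondecreasing_seq (fun n => ext_norm ri_set ri_norm (f_ n)) /\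
    ext_norm ri_set ri_norm (f_ n) @[n --> \oo] -->
      ext_norm ri_set ri_norm f ;
  ri_rearr : forall f g,
    measurable_fun [set: T] f -> measurable_fun [set: T] g ->
    (forall t, 0 < t -> rearr f t = rearr g t) ->
    ext_norm ri_set ri_norm f = ext_norm ri_set ri_norm g }.

(* Closedness under Hardy-Littlewood-Polya submajorization. For nonatomic
   sigma-finite mu it holds when X is maximal (norm-bounded increasing sequences
   of nonnegative functions of X have their limit in X) or minimal (simple
   functions supported by sets of finite measure are dense in X). It does not
   follow from the axioms of ri_space: closed r.i. ideals of Marcinkiewicz
   spaces may fail it, and then even the averages of f in X over the balls of
   a fixed radius may form a function outside X. *)
Definition majorization_closed (X : ri_space) :=
  forall f g, ri_set X f -> measurable_fun [set: T] g ->
  (forall s : R, 0 < s ->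
    (\int[lebesgue_measure]_(u in `]0%R, s[%classic) rearr g u <=
     \int[lebesgue_measure]_(u in `]0%R, s[%classic) rearr f u)%E) ->
  ri_set X g.

Definition cvx_set (X : ri_space) (a : R) : set (T -> R) :=
  [set f : T -> R | measurable_fun [set: T] f /\ ri_set X (fun x => `|f x| `^ a)].

Definition cvx_norm (X : ri_space) (a : R) : (T -> R) -> \bar R :=
  ext_norm (cvx_set X a) (fun f => ri_norm X (fun x => `|f x| `^ a) `^ a^-1).

Definition L_plus_Linfty (a : R) : set (T -> R) :=
  [set f | exists f0 f1 : T -> R,
    [/\ measurable_fun [set: T] f0, measurable_fun [set: T] f1,
        finite_norm mu a%:E f0, finite_norm mu +oo%E f1 & f = f0 \+ f1]].

Definition Kfun (N0 N1 : (T -> R) -> \bar R) (f : T -> R) (t : R) : \bar R :=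
  ereal_inf [set (N0 p.1 + t%:E * N1 p.2)%E | p in
    [set p : (T -> R) * (T -> R) |
      {ae mu, forall x, f x = p.1 x + p.2 x}]].

End rearrangement_invariant.

HB.mixin Record isBorel d (R : realType) T & Measurable d T & Metric R T := {
  borelE : @measurable d T = <<s @open T >>
}.

#[short(type="borelMetricType")]
HB.structure Definition BorelMetric d (R : realType) :=
  { T of Measurable d T & Metric R T & isBorel d R T }.

Section metric_measure.
Context {d : measure_display} {R : realType} {T : borelMetricType d R}.

Variable mu : {measure set T -> \bar R}.

Definition doubling :=
  (forall (x : T) (r : R), 0 < r -> (0 < mu (ball x r) < +oo)%E) /\
  exists2 C : R, 1 < C & forall (x : T) (r : R), 0 < r ->
    (mu (ball x (2 * r)) <= C%:E * mu (ball x r))%E.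

(* Real-valued integral and measure: for f in L^a + L^infty and r > 0 both
   are finite, so no information is lost. *)
Definition nabla (a r : R) (f : T -> R) (x : T) : R :=
  ((\int[mu]_(y in ball x r) (`|f x - f y| `^ a)) /
     fine (mu (ball x r))) `^ a^-1.

Definition smoothness (X : ri_space mu) (a : R) (f : T -> R) (r : R)
  : \bar R := cvx_norm X a (nabla a r f).

(* "mu-a.e. x, y": for all x, y outside a common null set *)
Definition hajlasz_grad (f : T -> R) : set (T -> R) :=
  [set g : T -> R | [/\ measurable_fun [set: T] g, forall x, 0 <= g x &
    exists2 Z, mu.-negligible Z & forall x y : T, ~ Z x -> ~ Z y ->
      `|f x - f y| <= mdist x y * (g x + g y)]].

Definition hom_sobolev_norm (X : ri_space mu) (a : R) (f : T -> R)
  : \bar R :=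
  if `[< L_plus_Linfty mu a f >]
  then ereal_inf [set cvx_norm X a g | g in hajlasz_grad f] else +oo%E.

Definition sobolev_norm (X : ri_space mu) (a : R) (f : T -> R)
  : \bar R := (cvx_norm X a f + hom_sobolev_norm X a f)%E.

Definition preceq (P : (T -> R) -> R -> Prop)
    (A B : (T -> R) -> R -> \bar R) :=
  exists2 c : R, 0 < c & forall f t, P f t -> (A f t <= c%:E * B f t)%E.

End metric_measure.

(* Main.v *)
Require Import Defs.
From HB Require Import structures.
From mathcomp Require Import all_boot all_order all_algebra.
From mathcomp Require Import finmap.
From mathcomp Require Import all_classical all_reals all_analysis.
From mathcomp Require Import measurable_realfun ess_sup_inf ring lra.
Set Implicit Arguments.
Unset Strict Implicit.
Unset Printing Implicit Defensive.
Import Order.TTheory GRing.Theory Num.Theory.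
Import numFieldNormedType.Exports.
Local Open Scope classical_set_scope.
Local Open Scope ring_scope.

(** Write [A_t h x] for the average of [h] over [ball x t].

    Smoothness is bounded by [K].  If [f = f0 + f1] and [g] is a Hajlasz
    gradient of [f1], then [(nabla_t f)^a <= h + A_t h] almost everywhere, with
    [h = |f0|^a + t^a g^a], because [u |-> u^a] is subadditive.  So the matter
    is the norm of [A_t h].  On a net of centres of mesh [t], [A_t h] is
    controlled by the averages of [h] over balls of radius [2 t] of bounded
    overlap.  Replacing [h] on one set of finite measure by its average there
    does not increase the norm ([ri_average]): the measure has no atoms, so the
    set splits into pieces of equal measure on which [h] is nearly constant,
    and the average is the mean of the functions obtained by permuting these
    pieces cyclically, all equidistributed with [h].  For overlapping sets the
    replacements are done one after the other, each time keeping half of the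
    current function ([smear]); every point is hit a bounded number of times,
    so a fixed fraction of every average survives.  The Fatou property
    transfers the bound to [nabla_t f] when this function is known to be in the
    space.  The construction also decreases the integrals of [(h - l)^+], which
    by the layer cake formula means submajorization of decreasing
    rearrangements, and thus puts [nabla_t f] in the space when the space is
    closed under submajorization ([ball_average_bounds],
    [submajorization_excess], [smoothness_le_K]).

    [K] is bounded by the sum.  For [d(x,y) < s], comparing [f x] and [f y] with
    [f z] and averaging over [z] gives
    [|f x - f y| <= k (nabla_(2s) f x + nabla_(2s) f y)]
    ([nabla_oscillation]).  No averaging operator enters here, which is why no
    condition on the space is needed.  With [D = k nabla_(32t) f] this says that
    the intervals of radius [D] around the values of [f] meet pairwise within
    any ball of radius [6 t], so they have a common point, and interpolating
    these points between balls yields [f1] with [|f - f1| <= D], of Lipschitz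
    constant of order [D x / t] near [x] ([lipschitz_regularization]).  At
    distances [d(x,y)] of order [2^j t >= t] the same oscillation bound at
    scale [2^j t] applies.  So [f1] has a gradient of order [Ga / t] as soon as
    [nabla_(2^j t) f <= 2^j Ga] for every [j], and the [a]-th powers being
    summable in the space, [Ga^a] is obtained by completeness
    ([ri_series], [dyadic_envelope], [K_le_smoothness_sum]).

    The inhomogeneous functional is compared with the homogeneous one by the
    quasi-triangle inequality, using the decomposition [f = f + 0] when [t > 1]
    ([Kinh_le_Kmin], [Kmin_le_Kinh]). *)

(** * Powers and level sets *)

Section power_inequalities.
Context {R : realType}.
Implicit Types a x y : R.

Lemma powR_subadditive a x y : 0 < a -> a <= 1 -> 0 <= x -> 0 <= y ->
  (x + y) `^ a <= x `^ a + y `^ a.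
Proof.
move=> a0 a1 x0 y0.
have [s0|s0] := eqVneq (x + y) 0.
  by rewrite s0 powR0 ?gt_eqF// addr_ge0// powR_ge0.
have {}s0 : 0 < x + y by rewrite lt_neqAle eq_sym s0 addr_ge0.
have frac z : 0 <= z -> z <= x + y -> z / (x + y) * (x + y) `^ a <= z `^ a.
  move=> z0 zs; have [->|zn0] := eqVneq z 0; first by rewrite !mul0r powR_ge0.
  have zp : 0 < z by rewrite lt_neqAle eq_sym zn0.
  rewrite -{2}(@divfK _ (x + y) _ z) ?gt_eqF//.
  rewrite powRM ?divr_ge0 ?(ltW s0)// ler_wpM2r ?powR_ge0//.
  by rewrite ger1_powR// divr_gt0//= ler_pdivrMr// mul1r.
rewrite -[leLHS]mul1r -{1}(@divff _ (x + y)) ?gt_eqF// mulrDl mulrDl.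
by rewrite lerD// frac// ?lerDl ?lerDr.
Qed.

(** The power of a sum is at most the power of twice the larger term. *)
Lemma powR_addr_max a x y : 0 < a -> 0 <= x -> 0 <= y ->
  (x + y) `^ a <= 2 `^ a * (x `^ a + y `^ a).
Proof.
move=> a0; wlog xy : x y / x <= y.
  move=> H x0 y0; have [/H|/ltW/H] := leP x y; first exact.
  by rewrite addrC [x `^ a + _]addrC; exact.
move=> x0 y0; apply: (@le_trans _ _ ((2 * y) `^ a)).
  by apply: ge0_ler_powR; rewrite ?nnegrE; lra.
by rewrite powRM// ler_wpM2l ?powR_ge0// lerDr powR_ge0.
Qed.

Lemma powRK a x : a != 0 -> 0 <= x -> (x `^ a) `^ a^-1 = x.
Proof. by move=> a0 x0; rewrite -powRrM mulfV// powRr1. Qed.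

Lemma powRVK a x : a != 0 -> 0 <= x -> (x `^ a^-1) `^ a = x.
Proof. by move=> a0 x0; rewrite -powRrM mulVf// powRr1. Qed.

End power_inequalities.

Section level_sets.
Context {d : measure_display} {T : measurableType d} {R : realType}.
Implicit Types f g : T -> R.

Lemma measurable_ltr_set f g : measurable_fun setT f -> measurable_fun setT g ->
  measurable [set x | f x < g x].
Proof.
by move=> mf mg; rewrite -preimage_true -[_ @^-1` _]setTI; exact: measurable_fun_ltr.
Qed.

Lemma measurable_ler_set f g : measurable_fun setT f -> measurable_fun setT g ->
  measurable [set x | f x <= g x].
Proof.
by move=> mf mg; rewrite -preimage_true -[_ @^-1` _]setTI; exact: measurable_fun_ler.
Qed.

End level_sets.

(** * Ideal property and Fatou property of r.i. norms *)

Section ri_basics.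
Context {d : measure_display} {T : measurableType d} {R : realType}.
Variables (mu : {measure set T -> \bar R}) (X : ri_space mu).
Implicit Types f g v : T -> R.

Lemma eq_rearr f g :
  (forall s : R, 0 <= s -> mu [set x | s < `|f x|] = mu [set x | s < `|g x|]) ->
  forall t, rearr mu f t = rearr mu g t.
Proof.
move=> fg t; congr ereal_inf; apply/seteqP; split=> _ /= [s [s0 sE] <-];
  by exists s => //; split=> //; rewrite ?fg// -fg.
Qed.

Lemma ext_norm_fin (c : R) f :
  (ext_norm (ri_set X) (ri_norm X) f <= c%:E)%E <->
  ri_set X f /\ ri_norm X f <= c.
Proof.
rewrite /ext_norm; case: asboolP => Xf; first by rewrite lee_fin; split=> // -[].
by split=> [|[]//]; rewrite leye_eq.
Qed.

Lemma ri_equidistributed f g : ri_set X f -> measurable_fun setT g ->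
  (forall s : R, 0 <= s -> mu [set x | s < `|f x|] = mu [set x | s < `|g x|]) ->
  ri_set X g /\ ri_norm X g = ri_norm X f.
Proof.
move=> Xf mg fg.
have := ri_rearr X (ri_meas Xf) mg (fun t _ => eq_rearr fg t).
rewrite /ext_norm (asboolT Xf); case: asboolP => // Xg [->]; split => //.
Qed.

Lemma ri_abs f : ri_set X f -> ri_set X (fun x => `|f x|) /\
  ri_norm X (fun x => `|f x|) = ri_norm X f.
Proof.
move=> Xf; apply: ri_equidistributed => //.
  exact/measurableT_comp/(ri_meas Xf).
by move=> s _; congr (mu _); apply/seteqP; split=> x /=; rewrite normr_id.
Qed.

(** Apply the monotone convergence axiom to the sequence [|g|, |f|, |f|, ...]. *)
Lemma ri_ideal f g : ri_set X f -> measurable_fun setT g ->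
  {ae mu, forall x, `|g x| <= `|f x|} ->
  ri_set X g /\ ri_norm X g <= ri_norm X f.
Proof.
move=> Xf mg gf.
have mf := ri_meas Xf.
have [Xaf naf] := ri_abs Xf.
pose u n x := if n is 0%N then `|g x| else `|f x|.
have mu_ n : measurable_fun setT (u n).
  by case: n => [|n]; apply: measurableT_comp.
have [] := @ri_mono _ _ _ _ X u (fun x => `|f x|) mu_ _ Xaf.
  apply: filterS gf => x gf; split.
  - by case=> [|n] /=.
  - apply/nondecreasing_seqP => -[|n] //=.
  - rewrite -(cvg_shiftS (fun n => u n x)) /=; exact: cvg_cst.
move=> nd _; have := nd 0%N 1%N isT.
rewrite {2}/ext_norm (asboolT Xaf) => /ext_norm_fin[Xag nag].
have [|Xg ng] := ri_equidistributed Xag mg.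
  by move=> s _; congr (mu _); apply/seteqP; split=> x /=; rewrite normr_id.
by split=> //; rewrite ng -naf.
Qed.

Lemma ri_ae_eq f g : ri_set X f -> measurable_fun setT g ->
  {ae mu, forall x, f x = g x} -> ri_set X g /\ ri_norm X g = ri_norm X f.
Proof.
move=> Xf mg fg.
have [|Xg ng] := ri_ideal Xf mg; first by apply: filterS fg => x ->.
have [|_ nf] := ri_ideal Xg (ri_meas Xf); first by apply: filterS fg => x ->.
by split=> //; apply/eqP; rewrite eq_le ng.
Qed.

(** The Fatou property in the only form the axioms grant: the limit has to be in the space beforehand. *)
Lemma ri_monotone_limit v (u : nat -> T -> R) (c : R) : ri_set X v ->
  (forall n, measurable_fun setT (u n)) -> (forall n x, 0 <= u n x) ->
  (forall x, nondecreasing_seq (u ^~ x)) -> (forall x, u n x @[n --> \oo] --> v x) ->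
  (forall n, ri_set X (u n) /\ ri_norm X (u n) <= c) -> ri_norm X v <= c.
Proof.
move=> Xv mu_ u0 nd uv uc.
have [|_] := @ri_mono _ _ _ _ X u v mu_ _ Xv.
  by apply: aeW => x; split.
rewrite /ext_norm (asboolT Xv) => uv'.
suff /ext_norm_fin[] : (ext_norm (ri_set X) (ri_norm X) v <= c%:E)%E by [].
rewrite /ext_norm (asboolT Xv) -(cvg_lim _ uv')//.
apply: lime_le; first by apply/cvg_ex; exists (ri_norm X v)%:E.
by apply: nearW => n; apply/ext_norm_fin.
Qed.

Lemma ri_norm_indic_gt0 (E : set T) : measurable E -> (0 < mu E < +oo)%E ->
  0 < ri_norm X \1_E.
Proof.
move=> mE /andP[E0 Eoo]; have XE := ri_indic X mE Eoo.
rewrite lt_neqAle eq_sym ri_norm_ge0// andbT; apply/eqP.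
move=> /(ri_norm_eq0 XE)/= [N [mN N0]] sub; suff : (mu E <= 0)%E by rewrite leNgt E0.
rewrite -N0 le_measure ?inE// => x Ex; apply: sub => /=.
by rewrite indicE mem_set//; apply/eqP; rewrite oner_eq0.
Qed.

End ri_basics.

(** * Splitting sets of a measure without atoms *)

(** For a Borel measure on a separable metric space without point masses, the balls
    of a countable family witness this; it is the only form in which the absence
    of atoms is used. *)
Definition has_small_cover {d} {T : measurableType d} {R : realType}
    (mu : {measure set T -> \bar R}) :=
  exists2 U : nat -> set T, (forall n, measurable (U n)) &
    forall x (e : R), 0 < e -> exists2 n, U n x & (mu (U n) <= e%:E)%E.

Section nonatomic.
Context {d : measure_display} {T : measurableType d} {R : realType}.
Variable mu : {measure set T -> \bar R}.
Hypothesis mu_small : has_small_cover mu.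
Implicit Types (E F G : set T) (h : T -> R).

(** Greedy construction: run through the covering family and add each trace on [G]
    that does not push the measure above [th].  If the union had measure less
    than [th], every point of [G] would lie in a member small enough to have
    been added, so the union would be all of [G]. *)
Lemma exact_subset G (th : R) : measurable G -> 0 <= th -> (th%:E <= mu G)%E ->
  exists F, [/\ measurable F, F `<=` G & mu F = th%:E].
Proof.
move=> mG th0 thG; have [U mU Usmall] := mu_small.
pose add (F : set T) n := F `|` (G `&` U n).
pose F := fix F n := if n is k.+1 then
  (if `[< (mu (add (F k) k) <= th%:E)%E >] then add (F k) k else F k) else set0.
have FS n : F n.+1 =
    if `[< (mu (add (F n) n) <= th%:E)%E >] then add (F n) n else F n by [].
have mF n : measurable (F n).
  elim: n => [|n IH]; first exact: measurable0.
  rewrite FS; case: ifP => // _; apply: measurableU => //.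
  exact: measurableI.
have FG n : F n `<=` G.
  elim: n => [|n IH]; first exact: sub0set.
  by rewrite FS; case: ifP => // _ x [/IH//|[]].
have Fth n : (mu (F n) <= th%:E)%E.
  by elim: n => [|n IH]; rewrite ?measure0 ?lee_fin// FS; case: asboolP.
have ndF : {homo F : n m / (n <= m)%N >-> (n <= m)%O}.
  apply/nondecreasing_seqP => n; rewrite FS; case: ifP => _; apply/subsetPset => //.
  exact: subsetUl.
have mUF : measurable (\bigcup_n F n) by exact: bigcup_measurable.
have cvF := @nondecreasing_cvg_mu _ _ _ mu _ mF mUF ndF.
have leth : (mu (\bigcup_n F n) <= th%:E)%E.
  rewrite -(cvg_lim _ cvF)//; apply: lime_le; last exact: nearW.
  by apply/cvg_ex; eexists; exact: cvF.
exists (\bigcup_n F n); split=> //; first by move=> x [n _ /FG].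
apply/eqP; rewrite eq_le leth/= leNgt; apply/negP => lt_th.
suff GF : G `<=` \bigcup_n F n.
  have /(le_trans thG) : (mu G <= mu (\bigcup_n F n))%E.
    by apply: le_measure => //; rewrite inE.
  by rewrite leNgt lt_th.
move=> x Gx.
have finU : mu (\bigcup_n F n) \is a fin_num.
  by rewrite ge0_fin_numE// (lt_trans lt_th)// ltry.
have [|n Unx Une] := Usmall x (th - fine (mu (\bigcup_n F n))).
  by rewrite subr_gt0 -lte_fin fineK.
exists n.+1 => //; rewrite FS asboolT; first by right.
rewrite (le_trans (measureU2 _ _ _))//; first exact: measurableI.
have -> : th = fine (mu (\bigcup_n F n)) + (th - fine (mu (\bigcup_n F n))).
  by rewrite addrC subrK.
rewrite EFinD leeD//.
  by rewrite fineK// le_measure ?inE//; apply: bigcup_sup.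
by apply: le_trans Une; rewrite le_measure ?inE//; apply: measurableI.
Qed.

(** The level [la] is the supremum of the levels [c] for which [h < c] on a set of
    measure at most [th]; a set inside [h = la] makes up for the missing
    measure. *)
Lemma level_cut E h (l u th : R) : measurable E -> (mu E < +oo)%E ->
  measurable_fun setT h -> l <= u -> (forall x, E x -> l <= h x <= u) ->
  0 <= th -> (th%:E <= mu E)%E ->
  exists F (la : R), [/\ [/\ measurable F, F `<=` E & mu F = th%:E], l <= la <= u,
    forall x, F x -> h x <= la & forall x, E x -> ~ F x -> la <= h x].
Proof.
move=> mE Eoo mh lu hlu th0 thE.
pose below c := E `&` [set x | h x < c].
have mbelow c : measurable (below c).
  apply: measurableI => //.
  exact: measurable_ltr_set.
have mbelow' c : measurable (E `&` [set x | h x <= c]).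
  apply: measurableI => //.
  exact: measurable_ler_set.
pose A : set R := [set c | l <= c <= u /\ (mu (below c) <= th%:E)%E].
have Al : A l.
  rewrite /A/= lexx lu; split=> //.
  rewrite (_ : below l = set0) ?measure0 ?lee_fin//.
  by rewrite -subset0 => x [/hlu/andP[+ _] /=]; rewrite leNgt => /negP.
have supA : has_sup A by split; [exists l|exists u => c [/andP[]]].
pose la := sup A.
have lla : l <= la by apply: ub_le_sup => //; case: supA.
have lau : la <= u by apply: ge_sup; [exists l|move=> c [/andP[]]].
have inv_lt (x : R) : 0 < x -> exists n : nat, n.+1%:R^-1 < x.
  by move=> /ltr_add_invr[n]; rewrite add0r; exists n.
have invmono n m : (n <= m)%N -> (m.+1%:R^-1 : R) <= n.+1%:R^-1.
  by move=> nm; rewrite lef_pV2 ?posrE ?ltr0n// ler_nat.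
have lo : (mu (below la) <= th%:E)%E.
  have -> : below la = \bigcup_n below (la - n.+1%:R^-1).
    apply/seteqP; split=> [x [Ex /= hx]|x [n _ [Ex /= hx]]].
      have [|n nhx] := inv_lt (la - h x); first by rewrite subr_gt0.
      by exists n => //; split=> //=; rewrite ltrBrDr addrC -ltrBrDr.
    by split=> //=; rewrite (lt_le_trans hx)// gerBl invr_ge0.
  have nd : {homo (fun n => below (la - n.+1%:R^-1)) : n m / (n <= m)%N >-> (n <= m)%O}.
    move=> n m nm; apply/subsetPset => x [Ex /= hx]; split=> //=.
    by rewrite (lt_le_trans hx)// lerD2l lerN2 invmono.
  have cvb := @nondecreasing_cvg_mu _ _ _ mu _ (fun n => mbelow (la - n.+1%:R^-1))
    (bigcup_measurable (fun n _ => mbelow (la - n.+1%:R^-1))) nd.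
  rewrite -(cvg_lim _ cvb)//; apply: lime_le.
    by apply/cvg_ex; eexists; exact: cvb.
  apply: nearW => n.
  have [c [_ Ac] lac] := @sup_adherent _ A n.+1%:R^-1 (ltac:(by rewrite invr_gt0)) supA.
  apply: le_trans Ac; apply: le_measure; rewrite ?inE//.
  by move=> x [Ex /= hx]; split=> //=; rewrite (lt_trans hx).
have hi : (th%:E <= mu (E `&` [set x | h x <= la]%R))%E.
  have eI : (E `&` [set x | h x <= la]%R) = \bigcap_n below (la + n.+1%:R^-1).
    apply/seteqP; split=> [x [Ex /= hx] n _|x H].
      by split=> //=; rewrite (le_lt_trans hx)// ltrDl invr_gt0.
    split; first by have [] := H 0%N I.
    rewrite /= leNgt; apply/negP => hx.
    have [|n nhx] := inv_lt (h x - la); first by rewrite subr_gt0.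
    have [_ /=] := H n I.
    by rewrite ltNge -lerBrDl (ltW nhx).
  have ni : {homo (fun n => below (la + n.+1%:R^-1)) : n m / (n <= m)%N >-> (m <= n)%O}.
    move=> n m nm; apply/subsetPset => x [Ex /= hx]; split=> //=.
    by rewrite (lt_le_trans hx)// lerD2l invmono.
  have mI : measurable (\bigcap_n below (la + n.+1%:R^-1)) by rewrite -eI.
  have b0 : (mu (below (la + 1%:R^-1)%R) < +oo)%E.
    by apply: le_lt_trans Eoo; apply: le_measure; rewrite ?inE// => x [].
  have cvb := @nonincreasing_cvg_mu _ _ _ mu _ b0 (fun n => mbelow (la + n.+1%:R^-1)) mI ni.
  rewrite eI -(cvg_lim _ cvb)//; apply: lime_ge.
    by apply/cvg_ex; eexists; exact: cvb.
  apply: nearW => n /=.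
  have [cu|uc] := leP (la + n.+1%:R^-1) u; last first.
    apply: (le_trans thE); apply: le_measure; rewrite ?inE//.
    by move=> x Ex; split=> //=; have /andP[_ /le_lt_trans] := hlu x Ex; exact.
  rewrite leNgt; apply/negP => /ltW Hle.
  have : la + n.+1%:R^-1 <= la.
    apply: ub_le_sup; first by case: supA.
    by split=> //; rewrite cu andbT (le_trans lla)// lerDl invr_ge0.
  by apply/negP; rewrite -ltNge ltrDl invr_gt0.
have finlo : mu (below la) \is a fin_num.
  by rewrite ge0_fin_numE// (le_lt_trans lo)// ltry.
pose G := (E `&` [set x | h x <= la]%R) `\` below la.
have mG : measurable G by exact: measurableD.
have sub : below la `<=` (E `&` [set x | h x <= la]%R).
  by move=> x [Ex /= /ltW].
have eG : mu (E `&` [set x | h x <= la]%R) = (mu (below la) + mu G)%E.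
  rewrite -measureU//; last by rewrite /G setDE setICA setICr setI0.
  by rewrite setDUK.
have [||F [mF FG Fth]] := @exact_subset G (th - fine (mu (below la))) mG.
- by rewrite subr_ge0 -lee_fin fineK.
- by move: hi; rewrite EFinB fineK// leeBlDl// eG.
exists (below la `|` F), la; split; rewrite ?lla//.
- split; first exact: measurableU.
  + by move=> x [[]//|/FG[[]]].
  + rewrite measureU//; last first.
      by rewrite -subset0 => x [bx /FG[_]].
    by rewrite [LHS](congr1 (fun z => mu (below la) + z)%E Fth) -{1}(fineK finlo) -EFinD addrC subrK.
- by move=> x [[_ /= /ltW]//|/FG[[]]].
- move=> x Ex nF; rewrite leNgt; apply/negP => hx; apply: nF; left; split=> //.
Qed.

End nonatomic.

Section equal_pieces.
Context {d : measure_display} {T : measurableType d} {R : realType}.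
Variable mu : {measure set T -> \bar R}.
Hypothesis mu_small : has_small_cover mu.
Implicit Types (E F G : set T) (h : T -> R).

Lemma integral_le_cst E h (u : R) : measurable E -> measurable_fun setT h ->
  (forall x, E x -> 0 <= h x <= u) ->
  (\int[mu]_(x in E) (h x)%:E <= u%:E * mu E)%E.
Proof.
move=> mE mh hu; rewrite -integral_cst//; apply: ge0_le_integral => //.
- by move=> x /hu/andP[h0 _]; rewrite lee_fin.
- exact/measurable_EFinP/measurable_funTS.
- by move=> x /hu/andP[h0 hxu]; rewrite lee_fin.
Qed.

(** Pieces are cut off by decreasing values of [h].  Since consecutive pieces have
    adjacent ranges of values, the lower sum misses the integral by at most one
    full oscillation [u - l] on one piece. *)
Lemma equal_pieces n E h (l u de : R) : measurable E ->
  mu E = (n.+1%:R * de)%:E -> 0 <= de -> measurable_fun setT h -> 0 <= l -> l <= u ->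
  (forall x, E x -> l <= h x <= u) ->
  exists (F : nat -> set T) (b : nat -> R),
  [/\ [/\ forall i, measurable (F i), trivIset setT F,
          forall i, (n < i)%N -> F i = set0, E = \bigcup_i F i &
          forall i, (i <= n)%N -> mu (F i) = de%:E],
      forall i, l <= b i, forall i x, F i x -> b i <= h x &
      (\int[mu]_(x in E) (h x)%:E <= (de * (\sum_(i < n.+1) b i + (u - l)))%:E)%E].
Proof.
elim: n E u => [|n IH] E u mE muE de0 mh l0 lu hlu.
  exists (fun i => if i is 0%N then E else set0), (fun=> l); split.
  - split=> //.
    + by case.
    + apply/trivIsetP => -[|i] [|j] _ _ //; rewrite ?set0I ?setI0//.
    + by case.
    + by apply/seteqP; split=> [x Ex|x [[|i] _] //]; exists 0%N.
    + by case=> // _; rewrite muE mul1r.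
  - by [].
  - by case=> // x /hlu/andP[].
  - rewrite big_ord1 addrC subrK; apply: le_trans (_ : (u%:E * mu E <= _)%E).
      apply: integral_le_cst => // x /hlu/andP[lh ->].
      by rewrite (le_trans l0).
    by rewrite muE mul1r -EFinM lee_fin mulrC.
have Eoo : (mu E < +oo)%E by rewrite muE ltry.
have nde0 : 0 <= n.+1%:R * de by rewrite mulr_ge0.
have [|G [la [[mG GE muG] /andP[lla lau] Gla Gla']]] :=
    @level_cut _ _ _ mu mu_small E h l u (n.+1%:R * de) mE Eoo mh lu hlu nde0.
  by rewrite muE lee_fin ler_wpM2r// ler_nat.
have mEG : measurable (E `\` G) by exact: measurableD.
have muEG : mu (E `\` G) = de%:E.
  transitivity (mu E - mu G)%E; first by rewrite measureD// setIidr.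
  by rewrite muE muG -EFinB -mulrBl -natrB// subSnn mul1r.
have [|F [b [[mF tF F0 EF muF] lb bF intF]]] := IH G la mG muG de0 mh l0 lla.
  by move=> x Gx; rewrite Gla//; have /andP[->] := hlu x (GE x Gx).
have FG i : F i `<=` G by rewrite EF; exact: bigcup_sup.
exists (fun i => if i == n.+1 then E `\` G else F i), (fun i => if i == n.+1 then la else b i).
split; [split| | |].
- by move=> i; case: ifP.
- apply/trivIsetP => i j _ _ ij.
  have [iE|_] := eqVneq i n.+1; have [jE|_] := eqVneq j n.+1.
  + by move: ij; rewrite iE jE => /eqP.
  + by rewrite -subset0 => x [[_ nGx] /FG].
  + by rewrite -subset0 => x [/FG Gx []].
  + by move/trivIsetP: tF; exact.
- by move=> i ni; rewrite gtn_eqF// F0// (ltn_trans _ ni).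
- apply/seteqP; split=> [x Ex|x [i _]]; last by case: ifP => [_ []|_ /FG /GE].
  have [|nGx] := pselect (G x); last by exists n.+1 => //=; rewrite ?eqxx.
  rewrite EF => -[i _ Fix]; exists i => //.
  case: eqP => // ie; move: Fix; rewrite F0// ie//.
- move=> i; rewrite leq_eqVlt; case: eqP => //= _; exact: muF.
- by move=> i; case: eqP.
- by move=> i x; case: eqP => [_ [Ex nGx]|_ /bF//]; exact: Gla'.
rewrite -(setDUK GE) ge0_integral_setU//; last 3 first.
- exact/measurable_EFinP/measurable_funTS.
- by move=> x; rewrite (setDUK GE) => /hlu/andP[lh _]; rewrite lee_fin (le_trans l0).
- by apply/disj_setPS => x [Gx []].
have le2 : (\int[mu]_(x in E `\` G) (h x)%:E <= (u * de)%:E)%E.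
  rewrite EFinM -muEG; apply: integral_le_cst => // x [/hlu/andP[lh ->] _].
  by rewrite (le_trans l0).
apply: (le_trans (leeD intF le2)); rewrite -EFinD lee_fin.
rewrite [X in _ <= _ * (X + _)]big_ord_recr/= eqxx.
rewrite [X in _ <= _ * (X + _ + _)](eq_bigr (fun i : 'I_n.+1 => b i)); last first.
  by move=> i _; rewrite ltn_eqF.
by rewrite [u * de]mulrC -mulrDr ler_wpM2l//; lra.
Qed.

End equal_pieces.

Definition cst_on {T : Type} {R : realType} (E : set T) (c : R) (h : T -> R) x :=
  if x \in E then c else h x.

Section rotation.
Context {d : measure_display} {T : measurableType d} {R : realType}.
Variables (mu : {measure set T -> \bar R}) (X : ri_space mu).
Implicit Types (E F G : set T) (h : T -> R).

Lemma measurable_fun_mem E : measurable E -> measurable_fun setT (fun x => x \in E).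
Proof.
move=> mE; apply: (measurable_fun_bool true).
by rewrite setTI preimage_true (_ : [set` _] = E)//; apply/seteqP; split=> x; rewrite /= inE.
Qed.

Lemma measurable_cst_on E c h : measurable E -> measurable_fun setT h ->
  measurable_fun setT (cst_on E c h).
Proof.
move=> mE mh; apply: measurable_fun_ifT => //; exact: measurable_fun_mem.
Qed.

Lemma ri_norm_sum n (f : 'I_n -> T -> R) (c : R) :
  (forall i, ri_set X (f i) /\ ri_norm X (f i) <= c) ->
  ri_set X (fun x => \sum_(i < n) f i x) /\
  ri_norm X (fun x => \sum_(i < n) f i x) <= n%:R * c.
Proof.
elim: n f => [|n IH] f fc.
  under eq_fun do rewrite big_ord0; split; first exact: ri_set0.
  rewrite mul0r; have /(ri_norm_eq0 (ri_set0 X)) -> // : {ae mu, forall x, cst 0 x = 0 :> R}.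
  exact: aeW.
have [|Xs ns] := IH (fun i => f (widen_ord (leqnSn n) i)); first by move=> i; exact: fc.
under eq_fun do rewrite big_ord_recr /=.
have [Xn nn] := fc ord_max.
split; first exact: ri_setD Xs Xn.
by rewrite (le_trans (ri_normD Xs Xn))// -natr1 mulrDl mul1r lerD.
Qed.

(** The new function is the mean of the cyclic shifts of the step function with
    value [b i] on [F i].  All shifts are equidistributed, as the pieces have
    equal measure, and the unshifted one is below [h]. *)
Lemma ri_cst_on_pieces n E h (de : R) (F : nat -> set T) (b : nat -> R) :
  ri_set X h -> (forall x, 0 <= h x) ->
  (forall i, measurable (F i)) -> trivIset setT F ->
  (forall i, (n < i)%N -> F i = set0) -> E = \bigcup_i F i ->
  (forall i, (i <= n)%N -> mu (F i) = de%:E) ->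
  (forall i x, F i x -> 0 <= b i <= h x) ->
  let g := cst_on E ((\sum_(i < n.+1) b i) / n.+1%:R) h in
  ri_set X g /\ ri_norm X g <= ri_norm X h.
Proof.
move=> Xh h0 mF tF F0 EF muF bF g.
have mE : measurable E by rewrite EF; exact: bigcup_measurable.
have mh := ri_meas Xh.
(* [i + s] is the addition of the cyclic group 'I_n.+1. *)
pose val (s : 'I_n.+1) x : R := \sum_(i < n.+1) b (i + s)%R * \1_(F i) x.
pose hs s x := if x \in E then val s x else h x.
have mhs s : measurable_fun setT (hs s).
  apply: measurable_fun_ifT => //; first exact: measurable_fun_mem.
  apply: measurable_sum => i; apply: measurable_funM; first exact: measurable_cst.
  have := @measurable_indic _ _ R setT _ (mF i); exact.
have FE i : F i `<=` E by rewrite EF; exact: bigcup_sup.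
have Fdisj i j x : F i x -> F j x -> i = j.
  move=> Fi Fj; apply/eqP; apply: contrapT => /negP ij.
  by move/trivIsetP : tF => /(_ i j I I ij); rewrite -subset0 => /(_ x); apply.
have hsF s (i : 'I_n.+1) x : F i x -> hs s x = b (i + s)%R.
  move=> Fix; rewrite /hs mem_set; last exact: FE Fix.
  rewrite /val (bigD1 i)//= indicE mem_set// mulr1 big1 ?addr0// => j ji.
  rewrite indicE memNset ?mulr0// => Fj; move: ji.
  by rewrite -(inj_eq val_inj)/= (Fdisj _ _ _ Fix Fj) eqxx.
have decomp A : measurable A ->
    mu A = (mu (A `\` E) + \sum_(i < n.+1) mu (A `&` F i))%E.
  move=> mA; rewrite -measure_semi_additive_ord//; last 3 first.
  - by move=> k; exact: measurableI.
  - apply/trivIsetP => i j _ _ ij; rewrite -subset0 => x [[_ Fi] [_ Fj]].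
    by move/eqP: ij; apply; apply/val_inj/(Fdisj _ _ _ Fi Fj).
  - by apply: bigsetU_measurable => i _; exact: measurableI.
  rewrite (_ : \big[_/_]_(_ < _) _ = A `&` E); last first.
    rewrite -(bigcup_mkord _ (fun i => A `&` F i)); apply/seteqP; split=> x.
      by case=> i _ [Ax Fx]; split=> //; exact: FE Fx.
    rewrite {1}EF => -[Ax [i _ Fx]]; exists i => //=.
    by rewrite ltnNge; apply/negP => /F0 FE0; rewrite FE0 in Fx.
  exact: measureDI.
have mlev s (r : R) : measurable [set x | r < `|hs s x|].
  by apply: measurable_ltr_set => //; exact: measurableT_comp.
have lev s (r : R) : mu [set x | r < `|hs s x|] =
    (mu ([set x | (r < `|h x|)%R] `\` E) +
     \sum_(i < n.+1) (if (r < `|b (i + s)%R|)%R then de%:E else 0))%E.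
  rewrite decomp//; congr (_ + _)%E.
    congr (mu _); apply/seteqP.
    by split=> x [/= H nE]; split=> //; move: H; rewrite /= /hs memNset.
  apply: eq_bigr => i _; case: ifP => [rb|/negP rb].
    rewrite (_ : _ `&` _ = F i); first by rewrite muF// -ltnS.
    by apply/seteqP; split=> [x []//|x Fx]; split=> //=; rewrite (hsF s i).
  rewrite (_ : _ `&` _ = set0) ?measure0//.
  by rewrite -subset0 => x [/= + Fx]; rewrite (hsF s i).
have hs0 x : 0 <= hs 0%R x <= h x.
  have [Ex|nEx] := pselect (E x); last by rewrite /hs memNset// lexx h0.
  have := Ex; rewrite {1}EF => -[i _ Fx].
  have ni : (i < n.+1)%N by rewrite ltnNge; apply/negP => /F0 FE0; rewrite FE0 in Fx.
  by rewrite (hsF _ (Ordinal ni))// addr0/=; exact: bF.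
have [|X0 nh0] := ri_ideal Xh (mhs 0%R).
  by apply: aeW => x; have /andP[? ?] := hs0 x; rewrite !ger0_norm.
have Xhs s : ri_set X (hs s) /\ ri_norm X (hs s) <= ri_norm X h.
  have [|Xs ->] := ri_equidistributed X0 (mhs s); last by [].
  move=> r _; rewrite !lev; congr (_ + _)%E.
  rewrite [LHS](reindex_inj (addrI s)); apply: eq_bigr => i _.
  by rewrite addr0 addrC.
have [Xsum nsum] := ri_norm_sum Xhs.
have n0 : 0 < n.+1%:R :> R by [].
have gE : g = (fun x => n.+1%:R^-1 * \sum_(s < n.+1) hs s x).
  apply/funext => x; rewrite /g /cst_on.
  have [Ex|nEx] := pselect (E x); last first.
    rewrite memNset//; under eq_bigr do rewrite /hs memNset//.
    by rewrite sumr_const card_ord -[X in _ = _ * X]mulr_natl mulKf ?gt_eqF.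
  rewrite mem_set//; have := Ex; rewrite {1}EF => -[i _ Fx].
  have ni : (i < n.+1)%N by rewrite ltnNge; apply/negP => /F0 FE0; rewrite FE0 in Fx.
  under [in RHS]eq_bigr do rewrite (hsF _ (Ordinal ni))//.
  rewrite mulrC; congr (_ * _).
  by rewrite [LHS](reindex_inj (addrI (Ordinal ni))).
rewrite gE; split; first exact: ri_setZ.
by rewrite ri_normZ// ger0_norm ?invr_ge0// ler_pdivrMl.
Qed.

End rotation.

(** * Averaging over one set *)

Section monotone.
Context {d : measure_display} {T : measurableType d} {R : realType}.
Variable mu : {measure set T -> \bar R}.
Implicit Types (E : set T) (h : T -> R).

Lemma integral_EFin_ge0 E h : (forall x, 0 <= h x) ->
  (0 <= \int[mu]_(x in E) (h x)%:E)%E.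
Proof. by move=> h0; apply: integral_ge0 => x _; rewrite lee_fin. Qed.

Lemma cvg_integral_nondecreasing E (u : nat -> T -> R) h : measurable E ->
  (forall n, measurable_fun setT (u n)) -> (forall n x, 0 <= u n x) ->
  (forall x, nondecreasing_seq (u ^~ x)) -> (forall x, u n x @[n --> \oo] --> h x) ->
  (\int[mu]_(x in E) (u n x)%:E)%E @[n --> \oo] --> (\int[mu]_(x in E) (h x)%:E)%E.
Proof.
move=> mE mu_ u0 nd uh.
rewrite (eq_integral (fun x => limn (fun n => (u n x)%:E))); last first.
  by move=> x _; apply/esym/cvg_lim => //; apply: cvg_EFin; [exact: nearW|exact: uh].
apply: cvg_monotone_convergence => //.
- by move=> n; exact/measurable_EFinP/measurable_funTS.
- by move=> n x _; rewrite lee_fin.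
- by move=> x _ n m nm; rewrite lee_fin; exact: nd.
Qed.

Lemma cvg_minr (r : R) : Num.min r n%:R @[n --> \oo] --> r.
Proof.
apply: cvg_near_cst; near=> n; apply: min_idPl.
near: n; exact: nbhs_infty_ger.
Unshelve. all: by end_near. Qed.

Lemma cvg_integral_truncation E h : measurable E -> measurable_fun setT h ->
  (forall x, 0 <= h x) ->
  (\int[mu]_(x in E) (Num.min (h x) n%:R)%:E)%E @[n --> \oo] -->
  (\int[mu]_(x in E) (h x)%:E)%E.
Proof.
move=> mE mh h0; apply: (@cvg_integral_nondecreasing E (fun n x => Num.min (h x) n%:R)) => //.
- by move=> n; exact: measurable_minr.
- by move=> n x; rewrite le_min h0 ler0n.
- by move=> x n m nm; rewrite le_min !ge_min lexx/= ler_nat nm orbT.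
- by move=> x; exact: cvg_minr.
Qed.

End monotone.

Section averaging.
Context {d : measure_display} {T : measurableType d} {R : realType}.
Variables (mu : {measure set T -> \bar R}) (X : ri_space mu).
Hypothesis mu_small : has_small_cover mu.
Implicit Types (E F G : set T) (h : T -> R).

Definition average E h : R := (\int[mu]_(x in E) h x) / fine (mu E).

Lemma average_ge0 E h : (forall x, 0 <= h x) -> 0 <= average E h.
Proof. by move=> h0; apply: divr_ge0; [exact: Rintegral_ge0|exact: fine_ge0]. Qed.

Lemma cst_on_ge0 E (c : R) h : 0 <= c -> (forall x, 0 <= h x) ->
  forall x, 0 <= cst_on E c h x.
Proof. by move=> c0 h0 x; rewrite /cst_on; case: ifP. Qed.

(** The value on [E] may be raised by [e] at the cost of [e] times the norm of the
    indicator of [E]. *)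
Lemma ri_cst_on_limit E h (m : R) : measurable E -> (mu E < +oo)%E ->
  measurable_fun setT h -> (forall x, 0 <= h x) -> 0 <= m ->
  forall B : R, (forall e, 0 < e -> exists c, [/\ m <= c + e, 0 <= c,
     ri_set X (cst_on E c h) & ri_norm X (cst_on E c h) <= B]) ->
  ri_set X (cst_on E m h) /\ ri_norm X (cst_on E m h) <= B.
Proof.
move=> mE Eoo mh h0 m0 B approx.
have XE := ri_indic X mE Eoo.
have key e : 0 < e -> ri_set X (cst_on E m h) /\
    ri_norm X (cst_on E m h) <= B + e * ri_norm X \1_E.
  move=> e0; have [c [mc c0 Xc nc]] := approx e e0.
  have XeE := ri_setZ e XE.
  have [|Xf nf] := ri_ideal (ri_setD Xc XeE) (measurable_cst_on m mE mh).
    apply: aeW => x; rewrite ger0_norm; last exact: cst_on_ge0.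
    rewrite ger0_norm; last first.
      apply: addr_ge0; first exact: cst_on_ge0.
      by apply: mulr_ge0; [exact: ltW|rewrite indicE].
    by rewrite /= /cst_on indicE; case: ifP => //= _; rewrite ?mulr1// mulr0 addr0.
  split=> //; rewrite (le_trans nf)// (le_trans (ri_normD Xc XeE))//.
  by rewrite ri_normZ// gtr0_norm// lerD.
split; first by have [] := key 1 ltr01.
apply/ler_addgt0Pr => e e0.
have n0 : 0 <= ri_norm X \1_E by exact: ri_norm_ge0.
have e'0 : 0 < e / (ri_norm X \1_E + 1) by rewrite divr_gt0// ltr_wpDl.
have [_ /le_trans] := key _ e'0; apply; rewrite lerD2l.
rewrite -mulrA ger_pMr// mulrC ler_pdivrMr ?ltr_wpDl// mul1r.
by rewrite lerDl.
Qed.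

(** With [n.+1] pieces of equal measure, the mean of the lower values misses the
    average by at most [M / n.+1]. *)
Lemma ri_cst_on_bounded E h (M : R) : measurable E -> (0 < mu E < +oo)%E ->
  ri_set X h -> (forall x, 0 <= h x) -> (forall x, E x -> h x <= M) ->
  let g := cst_on E (average E h) h in
  ri_set X g /\ ri_norm X g <= ri_norm X h.
Proof.
move=> mE /andP[E0 Eoo] Xh h0 hM g; have mh := ri_meas Xh.
have finE : mu E \is a fin_num by rewrite ge0_fin_numE.
have m0 : 0 < fine (mu E) by rewrite fine_gt0// E0 Eoo.
wlog M0 : M hM / 0 <= M.
  move=> H; apply: (H (Num.max M 0)); last by rewrite le_max lexx orbT.
  by move=> x /hM hxM; rewrite le_max hxM.
apply: ri_cst_on_limit => //; first exact: average_ge0.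
move=> e e0.
have [n nM] : exists n : nat, M / n.+1%:R <= e.
  exists (Num.truncn (M / e)); rewrite ler_pdivrMr// mulrC -ler_pdivrMr//.
  exact/ltW/truncnS_gt.
have n0 : (n.+1%:R : R) != 0 by rewrite pnatr_eq0.
have [|||F [b [[mF tF F0 EF muF] b0 bF intF]]] :=
  @equal_pieces _ _ _ mu mu_small n E h 0 M (fine (mu E) / n.+1%:R) mE _ _ mh (lexx 0) M0.
- by rewrite mulrC divfK// fineK.
- by rewrite divr_ge0// ltW.
- by move=> x Ex; rewrite h0 hM.
have bF' i x : F i x -> 0 <= b i <= h x by move=> Fx; rewrite b0 (bF _ _ Fx).
have [Xf nf] := ri_cst_on_pieces Xh h0 mF tF F0 EF muF bF'.
eexists; split; [| |exact: Xf|exact: nf]; last by rewrite divr_ge0// sumr_ge0.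
rewrite /average ler_pdivrMr// mulrDl.
have finI : (\int[mu]_(x in E) (h x)%:E)%E \is a fin_num.
  by rewrite ge0_fin_numE ?integral_EFin_ge0// (le_lt_trans intF)// ltry.
rewrite -lee_fin fineK// (le_trans intF)// lee_fin subr0 mulrDr lerD//.
  by rewrite mulrC mulrA mulrAC.
by rewrite mulrC mulrA mulrAC ler_wpM2r// ltW.
Qed.

(** The average of a truncation of [h], times the indicator of [E], is bounded in
    norm by [h], uniformly in the truncation. *)
Lemma ri_integrable_finite E h : measurable E -> (mu E < +oo)%E ->
  ri_set X h -> (forall x, 0 <= h x) -> (\int[mu]_(x in E) (h x)%:E < +oo)%E.
Proof.
move=> mE Eoo Xh h0; have mh := ri_meas Xh.
have [E0|E0] := eqVneq (mu E) 0.
  by rewrite null_set_integral//; exact/measurable_EFinP/measurable_funTS.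
have {}E0 : (0 < mu E)%E by rewrite measure_gt0.
have finE : mu E \is a fin_num by rewrite ge0_fin_numE.
have m0 : 0 < fine (mu E) by rewrite fine_gt0// E0 Eoo.
have XE := ri_indic X mE Eoo.
have n0 : 0 < ri_norm X \1_E by rewrite ri_norm_indic_gt0// E0 Eoo.
set B := (fine (mu E) * (ri_norm X h / ri_norm X \1_E))%:E.
apply: (@le_lt_trans _ _ B); last by rewrite ltry.
rewrite -(cvg_lim _ (@cvg_integral_truncation _ _ _ mu _ _ mE mh h0))//.
apply: lime_le; first by apply/cvg_ex; eexists; exact: cvg_integral_truncation.
apply: nearW => n; set k := fun x => Num.min (h x) n%:R.
have mk : measurable_fun setT k by exact: measurable_minr.
have k0 x : 0 <= k x by rewrite le_min h0 ler0n.
have kn x : k x <= n%:R by rewrite ge_min lexx orbT.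
have [|Xk nk] := ri_ideal Xh mk.
  by apply: aeW => x; rewrite !ger0_norm// ge_min lexx.
have E0oo : (0 < mu E < +oo)%E by rewrite E0.
have [Xg ng] := ri_cst_on_bounded mE E0oo Xk k0 (fun x _ => kn x).
have a0 := average_ge0 E k0.
have [|_] := ri_ideal Xg (ri_meas (ri_setZ (average E k) XE)).
  apply: aeW => x; rewrite ger0_norm; last by rewrite mulr_ge0// indicE.
  rewrite ger0_norm ?cst_on_ge0// /cst_on indicE.
  by case: ifP => _; rewrite ?mulr1// mulr0.
rewrite ri_normZ// ger0_norm// -ler_pdivlMr// => ak.
have kint : (\int[mu]_(x in E) (k x)%:E <= n%:R%:E * mu E)%E.
  by apply: integral_le_cst => // x _; rewrite k0 kn.
have finI : (\int[mu]_(x in E) (k x)%:E)%E \is a fin_num.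
  rewrite ge0_fin_numE ?integral_EFin_ge0//.
  by rewrite (le_lt_trans kint)// -(fineK finE) -EFinM ltry.
rewrite -(fineK finI) lee_fin -ler_pdivrMl// [leLHS]mulrC -[leLHS]/(average E k).
apply: (le_trans ak); rewrite ler_wpM2r ?invr_ge0 ?(ltW n0)//.
exact: le_trans ng nk.
Qed.

(** By truncation, from the case of functions bounded on [E]. *)
Lemma ri_average E h : measurable E -> (mu E < +oo)%E ->
  ri_set X h -> (forall x, 0 <= h x) ->
  let g := cst_on E (average E h) h in
  ri_set X g /\ ri_norm X g <= ri_norm X h.
Proof.
move=> mE Eoo Xh h0 g; have mh := ri_meas Xh.
have [E0|E0] := eqVneq (mu E) 0.
  have [|Xg ->] := ri_ae_eq Xh (measurable_cst_on (average E h) mE mh); last by [].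
  exists E; split=> // x /= gx; apply: contrapT => nEx; apply: gx.
  by rewrite /cst_on memNset.
have {}E0 : (0 < mu E)%E by rewrite measure_gt0.
have finE : mu E \is a fin_num by rewrite ge0_fin_numE.
have m0 : 0 < fine (mu E) by rewrite fine_gt0// E0 Eoo.
have hoo := ri_integrable_finite mE Eoo Xh h0.
have finI : (\int[mu]_(x in E) (h x)%:E)%E \is a fin_num.
  by rewrite ge0_fin_numE ?integral_EFin_ge0.
apply: ri_cst_on_limit => //; first exact: average_ge0.
move=> e e0.
have cv := @cvg_integral_truncation _ _ _ mu _ _ mE mh h0.
have me0 : 0 < e * fine (mu E) by rewrite mulr_gt0.
have [n Hn] : exists n : nat, (\int[mu]_(x in E) (h x)%:E <=
    \int[mu]_(x in E) (Num.min (h x) n%:R)%:E + (e * fine (mu E))%:E)%E.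
  apply: contrapT => /forallNP Hn.
  have : (\int[mu]_(x in E) (h x)%:E <=
      \int[mu]_(x in E) (h x)%:E - (e * fine (mu E))%:E)%E.
    rewrite -{1}(cvg_lim _ cv)//; apply: lime_le; first by apply/cvg_ex; eexists; exact: cv.
    apply: nearW => n; have /negP := Hn n; rewrite -ltNge => /ltW H.
    by rewrite leeBrDr.
  by rewrite -(fineK finI) -EFinB lee_fin leNgt ltrBlDr ltrDl me0.
set k := fun x => Num.min (h x) n%:R in Hn.
pose k' x := if x \in E then k x else h x.
have mk : measurable_fun setT k by exact: measurable_minr.
have mk' : measurable_fun setT k'.
  by apply: measurable_fun_ifT => //; exact: measurable_fun_mem.
have k0 x : 0 <= k x by rewrite le_min h0 ler0n.
have k'0 x : 0 <= k' x by rewrite /k'; case: ifP.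
have k'h x : k' x <= h x by rewrite /k'; case: ifP => // _; rewrite ge_min lexx.
have k'n x : E x -> k' x <= n%:R by move=> Ex; rewrite /k' mem_set// ge_min lexx orbT.
have [|Xk nk] := ri_ideal Xh mk'.
  by apply: aeW => x; rewrite !ger0_norm.
have E0oo : (0 < mu E < +oo)%E by rewrite E0.
have [Xg ng] := ri_cst_on_bounded mE E0oo Xk k'0 k'n.
have fE c : cst_on E c k' = cst_on E c h.
  by apply/funext => x; rewrite /cst_on /k'; case: (x \in E).
exists (average E k'); rewrite -fE; split; [|exact: average_ge0|exact: Xg|exact: le_trans ng nk].
rewrite /average ler_pdivrMr// mulrDl divfK ?gt_eqF//.
  have eI : (\int[mu]_(x in E) (k' x)%:E = \int[mu]_(x in E) (k x)%:E)%E.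
    by apply: eq_integral => x xE; rewrite /k' xE.
  have finK : (\int[mu]_(x in E) (k x)%:E)%E \is a fin_num.
    rewrite ge0_fin_numE ?integral_EFin_ge0//.
    rewrite (le_lt_trans _ hoo)//; apply: ge0_le_integral => //.
    - by move=> x _; rewrite lee_fin.
    - exact/measurable_EFinP/measurable_funTS.
    - exact/measurable_EFinP/measurable_funTS.
    - by move=> x _; rewrite lee_fin ge_min lexx.
  by rewrite -lee_fin EFinD /Rintegral eI fineK// fineK.
Qed.

End averaging.

(** * Averaging over overlapping sets *)

Section smearing.
Context {d : measure_display} {T : measurableType d} {R : realType}.
Variables (mu : {measure set T -> \bar R}) (X : ri_space mu).
Hypothesis mu_small : has_small_cover mu.
Implicit Types (E F G : set T) (h : T -> R).

(** Half of the function is kept, so that averaging over a later set does not destroy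
    what an earlier one produced. *)
Definition half_average E h x : R := (h x + cst_on E (average mu E h) h x) / 2.

Lemma half_average_ge0 E h : (forall x, 0 <= h x) -> forall x, 0 <= half_average E h x.
Proof.
move=> h0 x; apply: divr_ge0 => //; apply: addr_ge0 => //.
by apply: cst_on_ge0 => //; exact: average_ge0.
Qed.

Lemma measurable_half_average E h : measurable E -> measurable_fun setT h ->
  measurable_fun setT (half_average E h).
Proof.
move=> mE mh; apply: measurable_funM => //; apply: measurable_funD => //.
exact: measurable_cst_on.
Qed.

Lemma ri_half_average E h : measurable E -> (mu E < +oo)%E ->
  ri_set X h -> (forall x, 0 <= h x) ->
  ri_set X (half_average E h) /\ ri_norm X (half_average E h) <= ri_norm X h.
Proof.
move=> mE Eoo Xh h0; have [Xg ng] := ri_average mu_small mE Eoo Xh h0.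
have Xs := ri_setD Xh Xg.
rewrite (_ : half_average E h =
    (fun x => 2^-1 * (h \+ cst_on E (average mu E h) h) x)); last first.
  by apply/funext => x; rewrite /half_average mulrC.
split; first exact: ri_setZ.
rewrite ri_normZ// ger0_norm// ler_pdivrMl// mulr_natl mulr2n.
by rewrite (le_trans (ri_normD Xh Xg))// lerD2l.
Qed.

Lemma half_average_off E h x : ~ E x -> half_average E h x = h x.
Proof.
by move=> nEx; rewrite /half_average /cst_on memNset//; lra.
Qed.

Lemma half_average_on E h x : E x ->
  half_average E h x = (h x + average mu E h) / 2.
Proof. by move=> Ex; rewrite /half_average /cst_on mem_set. Qed.

(** Jensen inequality for the convex function [u |-> (u - la)^+]. *)
Lemma half_average_excess E h (la : R) : measurable E -> (mu E < +oo)%E ->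
  ri_set X h -> (forall x, 0 <= h x) -> 0 <= la ->
  (\int[mu]_x (Num.max (half_average E h x - la) 0)%:E <=
   \int[mu]_x (Num.max (h x - la) 0)%:E)%E.
Proof.
move=> mE Eoo Xh h0 la0; have mh := ri_meas Xh.
have mq := measurable_half_average mE mh.
have mCE : measurable (~` E) by exact: measurableC.
have mex (k : T -> R) : measurable_fun setT k ->
    measurable_fun setT (fun x => (Num.max (k x - la) 0)%:E).
  move=> mk; apply/measurable_EFinP; apply: measurable_maxr => //.
  exact: measurable_funB.
have split_int (k : T -> R) : measurable_fun setT k ->
    (\int[mu]_x (Num.max (k x - la) 0)%:E =
     \int[mu]_(x in E) (Num.max (k x - la) 0)%:E +
     \int[mu]_(x in ~` E) (Num.max (k x - la) 0)%:E)%E.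
  move=> mk; rewrite -[X in integral _ X _](setUv E) ge0_integral_setU//.
  - by rewrite setUv; exact: mex.
  - by move=> x _; rewrite lee_fin le_max lexx orbT.
  - by apply/disj_setPS => x [].
rewrite split_int// [leRHS]split_int//; apply: leeD; last first.
  by under eq_integral => x /set_mem nEx do rewrite half_average_off//.
set A := average mu E h.
have A0 : 0 <= A by exact: average_ge0.
set J := (\int[mu]_(x in E) (Num.max (h x - la) 0)%:E)%E.
have J0 : (0 <= J)%E by apply: integral_EFin_ge0 => x; rewrite le_max lexx orbT.
have AJ : ((Num.max (A - la) 0)%:E * mu E <= J)%E.
  have [E0|E0] := eqVneq (mu E) 0; first by rewrite E0 mule0.
  have {}E0 : (0 < mu E)%E by rewrite measure_gt0.
  have finE : mu E \is a fin_num by rewrite ge0_fin_numE.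
  have m0 : 0 < fine (mu E) by rewrite fine_gt0// E0 Eoo.
  have [Ala|laA] := leP (A - la) 0; first by rewrite mul0e.
  have hoo := ri_integrable_finite mu_small mE Eoo Xh h0.
  have finI : (\int[mu]_(x in E) (h x)%:E)%E \is a fin_num.
    by rewrite ge0_fin_numE ?integral_EFin_ge0.
  have -> : ((A - la)%:E * mu E = \int[mu]_(x in E) (h x)%:E - la%:E * mu E)%E.
    rewrite -(fineK finE) -(fineK finI) -!EFinM -EFinB mulrBl.
    by rewrite /A /average divfK ?gt_eqF.
  rewrite leeBlDr; last by rewrite -(fineK finE) -EFinM.
  rewrite -integral_cst// -ge0_integralD//; last 2 first.
  - by move=> x _; rewrite lee_fin le_max lexx orbT.
  - exact/measurable_funTS/mex.
  apply: ge0_le_integral => //.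
  - by move=> x _; rewrite lee_fin.
  - exact/measurable_EFinP/measurable_funTS.
  - apply: emeasurable_funD; last exact: measurable_cst.
    exact/measurable_funTS/mex.
  - by move=> x _; rewrite -EFinD lee_fin -lerBlDr le_max lexx.
apply: (@le_trans _ _ (\int[mu]_(x in E)
    ((2^-1)%:E * ((Num.max (h x - la) 0)%:E + (Num.max (A - la) 0)%:E)))%E).
  apply: ge0_le_integral => //.
  - by move=> x _; rewrite lee_fin le_max lexx orbT.
  - exact/measurable_funTS/mex.
  - apply: measurable_funeM; apply: emeasurable_funD; last exact: measurable_cst.
    exact/measurable_funTS/mex.
  - move=> x Ex; rewrite half_average_on// -EFinD -EFinM lee_fin.
    rewrite ge_max; apply/andP; split; last first.
      by rewrite mulr_ge0// addr_ge0// le_max lexx orbT.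
    apply: (@le_trans _ _ (2^-1 * ((h x - la) + (A - la)))); first by rewrite -/A; lra.
    by rewrite ler_wpM2l// lerD// le_max lexx.
rewrite ge0_integralZl//; last 2 first.
- apply: emeasurable_funD; last exact: measurable_cst.
  exact/measurable_funTS/mex.
- by move=> x _; rewrite -EFinD lee_fin addr_ge0// le_max lexx orbT.
rewrite ge0_integralD//; last 3 first.
- by move=> x _; rewrite lee_fin le_max lexx orbT.
- exact/measurable_funTS/mex.
- by move=> x _; rewrite lee_fin le_max lexx orbT.
rewrite (integral_cst mu mE (Num.max (A - la) 0)%:E) -/J.
apply: (@le_trans _ _ ((2^-1)%:E * (J + J))%E).
  by apply: lee_wpmul2l; [rewrite lee_fin|exact: leeD].
have [Joo|Joo] := eqVneq J +oo%E; first by rewrite Joo leey.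
have Jfin : J \is a fin_num by rewrite ge0_fin_numE// ltey.
by rewrite -(fineK Jfin) -EFinD -EFinM lee_fin; lra.
Qed.

Lemma le_average E h k (c : R) : measurable E -> (mu E < +oo)%E ->
  ri_set X h -> (forall x, 0 <= h x) -> ri_set X k -> (forall x, 0 <= k x) ->
  0 <= c -> (forall x, E x -> h x <= c * k x) -> average mu E h <= c * average mu E k.
Proof.
move=> mE Eoo Xh h0 Xk k0 c0 hk.
have hoo := ri_integrable_finite mu_small mE Eoo Xh h0.
have koo := ri_integrable_finite mu_small mE Eoo Xk k0.
have finh : (\int[mu]_(x in E) (h x)%:E)%E \is a fin_num.
  by rewrite ge0_fin_numE ?integral_EFin_ge0.
have fink : (\int[mu]_(x in E) (k x)%:E)%E \is a fin_num.
  by rewrite ge0_fin_numE ?integral_EFin_ge0.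
rewrite /average mulrA; apply: ler_wpM2r; first by rewrite invr_ge0 fine_ge0.
rewrite -lee_fin EFinM !fineK// -ge0_integralZl//; last 2 first.
- exact/measurable_EFinP/measurable_funTS/(ri_meas Xk).
- by move=> x _; rewrite lee_fin.
apply: ge0_le_integral => //.
- by move=> x _; rewrite lee_fin.
- exact/measurable_EFinP/measurable_funTS/(ri_meas Xh).
- by apply: measurable_funeM; exact/measurable_EFinP/measurable_funTS/(ri_meas Xk).
Qed.

Fixpoint smear (E : nat -> set T) h n :=
  if n is k.+1 then half_average (E k) (smear E h k) else h.

Variables (E : nat -> set T) (h : T -> R) (N : nat).
Hypotheses (mE : forall n, measurable (E n)) (Eoo : forall n, (mu (E n) < +oo)%E).
Hypotheses (Xh : ri_set X h) (h0 : forall x, 0 <= h x).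
Hypothesis overlap : forall x n, (\sum_(i < n) (x \in E i) <= N)%N.

Lemma smear_ge0 n x : 0 <= smear E h n x.
Proof. by elim: n x => [|n IH] //= x; exact: half_average_ge0. Qed.

Lemma ri_smear n : ri_set X (smear E h n) /\ ri_norm X (smear E h n) <= ri_norm X h.
Proof.
elim: n => [//|n [Xn nn]] /=.
have [Xs ns] := ri_half_average (mE n) (Eoo n) Xn (smear_ge0 n).
by split=> //; exact: le_trans ns nn.
Qed.

Lemma smear_excess n (la : R) : 0 <= la ->
  (\int[mu]_x (Num.max (smear E h n x - la) 0)%:E <=
   \int[mu]_x (Num.max (h x - la) 0)%:E)%E.
Proof.
move=> la0; elim: n => [//|n IH]; apply: le_trans IH.
by apply: half_average_excess => //; [exact: (ri_smear n).1|exact: smear_ge0].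
Qed.

(** A step halves the value at most, and only at the points of the set involved, so
    [2 ^ (number of sets met) * value] grows with the number of steps. *)
Lemma smear_growth k n x : (k <= n)%N ->
  smear E h k x <= 2 ^+ N * smear E h n x.
Proof.
move=> kn.
have mono : nondecreasing_seq (fun n => 2 ^+ (\sum_(i < n) (x \in E i))%N * smear E h n x).
  apply/nondecreasing_seqP => m; rewrite big_ord_recr/= exprD -mulrA.
  apply: ler_wpM2l; first exact: exprn_ge0.
  have [Ex|nEx] := pselect (E m x); last first.
    by rewrite memNset// expr0 mul1r half_average_off.
  rewrite mem_set// expr1 half_average_on// mulrC divfK//.
  by rewrite lerDl average_ge0//; exact: smear_ge0.
apply: (@le_trans _ _ (2 ^+ (\sum_(i < k) (x \in E i))%N * smear E h k x)).
  by rewrite ler_peMl ?smear_ge0// exprn_ege1// ler1n.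
apply: (le_trans (mono _ _ kn)).
by rewrite ler_wpM2r ?smear_ge0// ler_weXn2l ?ler1n.
Qed.

(** Step [k] produces half the average of a function that is at least [h / 2 ^ N];
    later steps lose another factor [2 ^ N]. *)
Lemma average_le_smear k n x : (k < n)%N -> E k x ->
  average mu (E k) h <= 2 * 2 ^+ N * 2 ^+ N * smear E h n x.
Proof.
move=> kn Ex.
have [Xk _] := ri_smear k.
have le1 : average mu (E k) h <= 2 ^+ N * average mu (E k) (smear E h k).
  apply: le_average => //; first exact: smear_ge0.
  by move=> y _; exact: (@smear_growth 0 k y).
apply: (le_trans le1).
have -> : 2 * 2 ^+ N * 2 ^+ N * smear E h n x =
    2 ^+ N * (2 * (2 ^+ N * smear E h n x)) by ring.
apply: ler_wpM2l; first exact: exprn_ge0.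
apply: (@le_trans _ _ (2 * smear E h k.+1 x)).
  by rewrite /= half_average_on// mulrC divfK// lerDr smear_ge0.
by rewrite ler_pM2l// smear_growth.
Qed.

End smearing.

(** * Balls of a doubling space *)

Section doubling_geometry.
Context {d : measure_display} {R : realType} {T : borelMetricType d R}.
Implicit Types (x y a : T) (r s : R).

Lemma ballE x r y : ball x r y <-> mdist x y < r.
Proof. by rewrite ballEmdist. Qed.

Lemma open_measurable_borel (A : set T) : open A -> measurable A.
Proof. by move=> oA; rewrite borelE; exact: sub_sigma_algebra. Qed.

Lemma subset_ball_add x y r s : mdist x y + r <= s -> ball y r `<=` ball x s.
Proof.
move=> xyrs z /ballE yz; apply/ballE.
by rewrite (le_lt_trans (metric_triangle x y z))// (lt_le_trans _ xyrs)// ltrD2l.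
Qed.

Lemma metric_ball_open x r : open (ball x r).
Proof.
rewrite openE => y /ballE xyr; rewrite /interior -nbhs_ballE /=.
exists (r - mdist x y); first by rewrite /= subr_gt0.
by apply: subset_ball_add; rewrite addrC subrK.
Qed.

Lemma measurable_metric_ball x r : measurable (ball x r).
Proof. exact/open_measurable_borel/metric_ball_open. Qed.

Lemma measurable_continuous (f : T -> R) : continuous f -> measurable_fun setT f.
Proof.
move=> cf; apply: (measurability _ (RGenOInfty.measurableE R)).
move=> _ [_ [x ->] <-]; rewrite setTI.
apply: open_measurable_borel; apply: open_comp; first by move=> y _; exact: cf.
exact: interval_open.
Qed.

(** The option accounts for nets with finitely many points, whose enumeration must
    not repeat centres. *)
Definition oball (o : option T) r : set T := if o is Some a then ball a r else set0.

Lemma measurable_oball o r : measurable (oball o r).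
Proof. by case: o => [a|]; [exact: measurable_metric_ball|exact: measurable0]. Qed.

Variable mu : {measure set T -> \bar R}.
Hypothesis mu_doubling : doubling mu.

Lemma ball_gt0 x r : 0 < r -> (0 < mu (ball x r))%E.
Proof. by move=> r0; have /andP[] := mu_doubling.1 x r r0. Qed.

Lemma ball_lty x r : 0 < r -> (mu (ball x r) < +oo)%E.
Proof. by move=> r0; have /andP[] := mu_doubling.1 x r r0. Qed.

Lemma ball_fin x r : 0 < r -> mu (ball x r) \is a fin_num.
Proof. by move=> r0; rewrite ge0_fin_numE// ball_lty. Qed.

Lemma fine_ball_gt0 x r : 0 < r -> 0 < fine (mu (ball x r)).
Proof. by move=> r0; rewrite fine_gt0// ball_gt0// ball_lty. Qed.

(** The doubling condition iterated and made independent of the centre. *)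
Definition doubling_bound (C : R) := 1 < C /\ forall k x y r s, 0 < s ->
  mdist x y + r <= 2 ^+ k * s -> (mu (ball x r) <= (C ^+ k)%:E * mu (ball y s))%E.

Lemma exists_doubling_bound : exists C, doubling_bound C.
Proof.
have [_ [C C1 dbl]] := mu_doubling; exists C; split=> // k x y r s s0 xyr.
apply: (@le_trans _ _ (mu (ball y (2 ^+ k * s)))).
  apply: le_measure; rewrite ?inE; [exact: measurable_metric_ball..|].
  by apply: subset_ball_add; rewrite metric_sym.
elim: {r xyr} k => [|k IH]; first by rewrite !expr0 mul1r mul1e.
rewrite exprS -mulrA (le_trans (dbl _ _ _))// ?mulr_gt0// ?exprn_gt0//.
rewrite exprS EFinM -muleA; apply: lee_wpmul2l => //.
by rewrite lee_fin (le_trans _ (ltW C1)).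
Qed.

Variable C : R.
Hypothesis dbl : doubling_bound C.

Lemma dbl_ge0 k : 0 <= C ^+ k.
Proof. by rewrite exprn_ge0// (le_trans _ (ltW dbl.1)). Qed.

(** Disjoint balls of radius [s] with centres near [x] all have measure comparable
    with that of a ball around [x] containing them. *)
Lemma packing_bound (I : choiceType) (P : {fset I}) (c : I -> option T) x r s k :
  0 < s -> 0 < r -> 2 * r + s <= 2 ^+ k * s ->
  trivIset [set` P] (fun i => oball (c i) s) ->
  (forall i, i \in P -> oball (c i) r x) -> (#|` P|%:R : R) <= C ^+ k.
Proof.
move=> s0 r0 rs tP cx.
have rs0 : 0 < r + s by rewrite addr_gt0.
rewrite -(@ler_pM2r _ (fine (mu (ball x (r + s)))) (fine_ball_gt0 x rs0)).
rewrite -lee_fin !EFinM !fineK ?ball_fin//.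
apply: (@le_trans _ _ (\sum_(i <- P) ((C ^+ k)%:E * mu (oball (c i) s)))%E).
  apply: (@le_trans _ _ (\sum_(i <- P) mu (ball x (r + s)))%E).
    rewrite -(fineK (ball_fin x rs0)) sumEFin lee_fin.
    rewrite big_const_seq count_predT iter_addr_0.
    by rewrite cardfE mulr_natl.
  rewrite big_seq [leRHS]big_seq; apply: lee_sum => i iP.
  move: (cx i iP); case: (c i) => //= a /ballE ax.
  apply: dbl.2 => //; rewrite metric_sym (le_trans _ rs)//.
  by rewrite mulr2n mulrDl mul1r addrA !lerD2r ltW.
rewrite -ge0_sume_distrr//; apply: lee_wpmul2l; first by rewrite lee_fin dbl_ge0.
rewrite -measure_fbigsetU//; last by move=> i _; exact: measurable_oball.
apply: le_measure; rewrite ?inE; [| exact: measurable_metric_ball|].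
  by apply: bigsetU_measurable => i _; exact: measurable_oball.
rewrite -bigcup_fset => y [i /= iP]; move: (cx i iP).
case: (c i) => //= a /ballE ax; apply: subset_ball_add.
by rewrite metric_sym lerD2r ltW.
Qed.

(** By the packing bound, each bounded region contains finitely many centres. *)
Lemma separated_countable (D : set T) s : 0 < s ->
  trivIset D (fun a => ball a s) -> countable D.
Proof.
move=> s0 tD.
have [->|/set0P[x0 Dx0]] := eqVneq D set0; first exact: countable0.
have finD n : finite_set (D `&` ball x0 n.+1%:R).
  apply: contrapT => infD.
  have [k Hk] : exists k : nat, 2 * n.+1%:R + s <= 2 ^+ k * s.
    exists (Num.truncn ((2 * n.+1%:R + s) / s)).+1.
    rewrite -ler_pdivrMr// (le_trans (ltW (truncnS_gt _)))//.
    by rewrite -natrX ler_nat ltnW// ltn_expl.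
  have [P PD cardP] := infinite_set_fset (Num.truncn (C ^+ k)).+1 infD.
  have : (#|` P|%:R : R) <= C ^+ k.
    apply: (@packing_bound _ P (fun a => Some a) x0 n.+1%:R s) => //.
      by apply: sub_trivIset tD => a /PD [].
    by move=> a /PD [_ /ball_sym].
  apply/negP; rewrite -ltNge (lt_le_trans (truncnS_gt _))//.
  by rewrite ler_nat.
rewrite (_ : D = \bigcup_n (D `&` ball x0 n.+1%:R)).
  by apply: bigcup_countable => // n _; exact: finite_set_countable.
apply/seteqP; split=> [a Da|a [n _ []//]].
exists (Num.truncn (mdist x0 a)) => //; split=> //.
by apply/ballE; exact: truncnS_gt.
Qed.

(** The centres of a maximal disjoint family of balls of radius [s / 2]. *)
Lemma exists_net : exists N : nat, forall s, 0 < s -> exists c : nat -> option T,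
  (forall x, exists k, oball (c k) s x) /\
  (forall x n, (\sum_(i < n) (x \in oball (c i) (2 * s)) <= N)%N).
Proof.
exists (Num.truncn (C ^+ 4)).+1 => s s0.
have s20 : 0 < s / 2 by rewrite divr_gt0.
have [D [_ tD maxD]] :=
  ex_maximal_disjoint_subcollection (fun a : T => ball a (s / 2)) setT.
have /countable_injP[f finj] := separated_countable s20 tD.
pose c i := xget None [set o | exists a, [/\ D a, f a = i & o = Some a]].
have cS i a : c i = Some a -> D a /\ f a = i.
  rewrite /c; case: xgetP => [_ -> [b [Db fb ->]] [<-]//|//].
have cD a : D a -> c (f a) = Some a.
  move=> Da; rewrite /c; case: xgetP => [_ -> [b [Db fb ->]]|/(_ (Some a))].
    by congr Some; apply: finj => //; rewrite inE.
  by case; exists a.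
exists c; split=> [x|x n].
  suff [a [Da ax]] : exists a, D a /\ ball a s x by exists (f a); rewrite cD.
  apply: contrapT => /forallNP noa.
  have nDx : ~ D x by move=> Dx; apply: (noa x); split=> //; exact: ballxx.
  have meet a : D a -> ball a (s / 2) `&` ball x (s / 2) !=set0 -> False.
    move=> Da [y [ay xy]]; apply: (noa a); split=> //.
    by have := ball_triangle ay (ball_sym xy); rewrite -splitr.
  apply: (maxD (D `|` [set x])) => //.
    by split; [exact: subsetUl|move=> /(_ x) H; apply/nDx/H; right].
  move=> a b [Da|->] [Db|->]// ab.
  - exact: tD.
  - by case: (meet _ Da).
  - by case: (meet _ Db); rewrite setIC.
rewrite -(ler_nat R).
have -> : (\sum_(i < n) (x \in oball (c i) (2 * s)))%N =
    #|` [fset i in [seq i <- iota 0 n | x \in oball (c i) (2 * s)]]%fset|.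
  rewrite card_fseq undup_id ?filter_uniq ?iota_uniq// size_filter -sum1_count.
  rewrite -(big_mkord xpredT (fun i => (x \in oball (c i) (2 * s)) : nat)).
  by rewrite /index_iota subn0 [RHS]big_mkcond; apply: eq_bigr => i _; case: ifP.
rewrite (@le_trans _ _ (C ^+ 4))//; last first.
  exact/ltW/truncnS_gt.
apply: (@packing_bound _ _ c x (2 * s) (s / 2)) => //.
- by rewrite mulr_gt0.
- by rewrite -[2 ^+ 4]natrX; lra.
- move=> i j _ _ [y []].
  case ci: (c i) => [a|//]; case cj: (c j) => [b|//] /= ay yb.
  have [Da fa] := cS _ _ ci; have [Db fb] := cS _ _ cj.
  have ab : a = b by apply: tD => //; exists y.
  by rewrite -fa -fb ab.
- by move=> i; rewrite !inE /= mem_filter => /andP[/set_mem].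
Qed.

Lemma doubling_small_cover : (forall x, mu [set x] = 0%E) -> has_small_cover mu.
Proof.
move=> mu0; have [N net] := exists_net.
pose sj (j : nat) : R := j.+1%:R^-1.
have sj0 j : 0 < sj j by rewrite invr_gt0.
have /choice[c /all_and2[cov _]] j := net (sj j) (sj0 j).
exists (fun n => if choice.unpickle n is Some ij then oball (c ij.1 ij.2) (sj ij.1) else set0).
  move=> n; case: choice.unpickle => [ij|]; [exact: measurable_oball|exact: measurable0].
move=> x e e0.
have cvx : mu (ball x (2 * sj n)) @[n --> \oo] --> 0%E.
  rewrite -(mu0 x) (_ : [set x] = \bigcap_n ball x (2 * sj n)); last first.
    apply/seteqP; split=> [_ -> n _|y xy]; first by apply: ballxx; rewrite mulr_gt0.
    apply/esym/mdist_positivity/eqP; rewrite eq_le mdist_ge0 andbT leNgt.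
    apply/negP => xy0; have d0 : 0 < mdist x y / 2 by rewrite divr_gt0.
    have [n] := ltr_add_invr d0; rewrite add0r => nxy.
    have /ballE := xy n I; apply/negP; rewrite -leNgt.
    by rewrite mulrC -ler_pdivlMr// ltW.
  apply: (@nonincreasing_cvg_mu _ _ _ mu (fun n => ball x (2 * sj n))).
  - by rewrite ball_lty// mulr_gt0.
  - by move=> n; exact: measurable_metric_ball.
  - by apply: bigcap_measurable => // n _; exact: measurable_metric_ball.
  - move=> n m nm; apply/subsetPset; apply: le_ball.
    by rewrite ler_pM2l// /sj lef_pV2 ?posrE ?ltr0n// ler_nat.
have [n mun] : exists n, (mu (ball x (2 * sj n)) <= e%:E)%E.
  apply: contrapT => /forallNP H.
  have : (e%:E <= 0%E)%E.
    rewrite -(cvg_lim _ cvx)//; apply: lime_ge; first by apply/cvg_ex; eexists; exact: cvx.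
    by apply: nearW => n; have /negP := H n; rewrite -ltNge => /ltW.
  by rewrite lee_fin leNgt e0.
have [k xk] := cov n x.
exists (choice.pickle (n, k)); rewrite choice.pickleK//=.
apply: le_trans mun; apply: le_measure; rewrite ?inE.
- exact: measurable_oball.
- exact: measurable_metric_ball.
- case: (c n k) xk => //= a /ballE ax; apply: subset_ball_add.
  by rewrite metric_sym mulr2n mulrDl !mul1r lerD2r ltW.
Qed.

End doubling_geometry.

(** * Averages over balls of a fixed radius *)

Section ball_averages.
Context {d : measure_display} {R : realType} {T : borelMetricType d R}.
Variable mu : {measure set T -> \bar R}.
Hypothesis mu_doubling : doubling mu.
Hypothesis mu_point : forall x : T, mu [set x] = 0%E.
Variable X : ri_space mu.
Implicit Types (h v : T -> R) (s : R).

Lemma oball_lty (o : option T) s : 0 < s -> (mu (oball o s) < +oo)%E.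
Proof. by case: o => [a|] s0 /=; [exact: ball_lty|rewrite measure0]. Qed.

(** Given a net of mesh [s], [ball x s] is contained in the ball of radius [2 s]
    around the centre nearest to [x], and the two have comparable measure. *)
Lemma ball_average_majorant : exists2 La : R, 0 < La &
  forall s h, 0 < s -> ri_set X h -> (forall x, 0 <= h x) ->
  exists (u : nat -> T -> R) (W : nat -> set T),
  [/\ [/\ forall n, measurable (W n), nondecreasing_seq W &
          forall x, exists n, W n x],
      forall n, ri_set X (u n) /\ ri_norm X (u n) <= ri_norm X h,
      forall n x, 0 <= u n x,
      forall n x, W n x -> h x + average mu (ball x s) h <= La * u n x &
      forall n (la : R), 0 <= la ->
        (\int[mu]_x (Num.max (u n x - la) 0)%:E <=
         \int[mu]_x (Num.max (h x - la) 0)%:E)%E].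
Proof.
have [C dbl] := exists_doubling_bound mu_doubling.
have mu_small := doubling_small_cover mu_doubling dbl mu_point.
have [N net] := exists_net mu_doubling dbl.
(* [2 ^+ N] for the loss on [h], the other term for the loss on its averages. *)
exists (2 ^+ N + C ^+ 2 * (2 * 2 ^+ N * 2 ^+ N)).
  by rewrite ltr_wpDr ?exprn_gt0// mulr_ge0 ?(dbl_ge0 dbl)// !mulr_ge0// exprn_ge0.
move=> s h s0 Xh h0; have [c [cov over]] := net s s0.
have s20 : 0 < 2 * s by rewrite mulr_gt0.
pose E i := oball (c i) (2 * s).
have mE i : measurable (E i) by exact: measurable_oball.
have Eoo i : (mu (E i) < +oo)%E by exact: oball_lty.
exists (smear mu E h), (fun n => \big[setU/set0]_(i < n) oball (c i) s); split.
- split.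
  + by move=> n; apply: bigsetU_measurable => i _; exact: measurable_oball.
  + by apply/nondecreasing_seqP => n; rewrite big_ord_recr/=; apply/subsetPset; exact: subsetUl.
  + move=> x; have [k xk] := cov x; exists k.+1.
    by rewrite big_ord_recr/=; right.
- by move=> n; exact: ri_smear.
- by move=> n x; exact: smear_ge0.
- move=> n x; rewrite /= -(bigcup_mkord n (fun i => oball (c i) s)) => -[k /= kn xk].
  rewrite mulrDl; apply: lerD; first exact: (@smear_growth _ _ _ _ _ _ _ h0 over 0 n x).
  rewrite -mulrA; apply: le_trans (_ : C ^+ 2 * average mu (E k) h <= _).
    move: xk; rewrite /E; case: (c k) => //= a /ballE ax.
    have sub : ball x s `<=` ball a (2 * s).
      by apply: subset_ball_add; rewrite mulr2n mulrDl mul1r lerD2r ltW.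
    have mx := measurable_metric_ball x s.
    have ma := measurable_metric_ball a (2 * s).
    have aoo := ball_lty mu_doubling a s20.
    have hoo := ri_integrable_finite mu_small ma aoo Xh h0.
    have mhE (A : set T) : measurable_fun A (fun x => (h x)%:E).
      exact/measurable_EFinP/measurable_funTS/(ri_meas Xh).
    have le1 : (\int[mu]_(y in ball x s) (h y)%:E <=
                \int[mu]_(y in ball a (2 * s)) (h y)%:E)%E.
      by apply: ge0_subset_integral => // y _; rewrite lee_fin.
    have fina : (\int[mu]_(y in ball a (2 * s)) (h y)%:E)%E \is a fin_num.
      by rewrite ge0_fin_numE ?integral_EFin_ge0.
    have finx : (\int[mu]_(y in ball x s) (h y)%:E)%E \is a fin_num.
      by rewrite ge0_fin_numE ?integral_EFin_ge0// (le_lt_trans le1).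
    rewrite /average mulrA ler_pdivrMr ?(fine_ball_gt0 mu_doubling)//.
    rewrite mulrAC ler_pdivlMr ?(fine_ball_gt0 mu_doubling)//.
    rewrite mulrC [leRHS]mulrAC; apply: ler_pM.
    + exact: fine_ge0.
    + exact: Rintegral_ge0.
    + rewrite -lee_fin EFinM !fineK ?(ball_fin mu_doubling)//.
      apply: dbl.2 => //; rewrite expr2; lra.
    + by rewrite -lee_fin !fineK.
  apply: ler_wpM2l; first exact: dbl_ge0 dbl _.
  apply: (@average_le_smear _ _ _ mu X mu_small E h N mE Eoo Xh h0 over) => //.
  move: xk; rewrite /E; case: (c k) => //= a; apply: le_ball; lra.
- by move=> n la la0; exact: (smear_excess (X := X)).
Qed.

Definition truncated (W : nat -> set T) v n x : R := if x \in W n then v x else 0.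

Lemma truncated_cvg (W : nat -> set T) v : (forall x, 0 <= v x) ->
  nondecreasing_seq W -> (forall x, exists n, W n x) ->
  [/\ forall n x, 0 <= truncated W v n x,
      forall x, nondecreasing_seq (truncated W v ^~ x) &
      forall x, truncated W v n x @[n --> \oo] --> v x].
Proof.
move=> v0 ndW covW; split=> [n x|x n m nm|x].
- by rewrite /truncated; case: ifP.
- rewrite /truncated; case: ifPn => [/set_mem Wx|_]; last by case: ifP.
  by rewrite mem_set//; exact: (subsetPset _ _ (ndW _ _ nm)).
- apply: cvg_near_cst; have [n Wnx] := covW x.
  exists n => // m /= nm; rewrite /truncated mem_set//.
  exact: (subsetPset _ _ (ndW _ _ nm)).
Qed.

Lemma measurable_truncated (W : nat -> set T) v n : measurable (W n) ->
  measurable_fun setT v -> measurable_fun setT (truncated W v n).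
Proof.
by move=> mW mv; apply: measurable_fun_ifT => //; exact: measurable_fun_mem.
Qed.

(** The average need not be in the space, so [v] is compared with the majorants on
    the exhausting sets [W n], and [n] tends to infinity afterwards. *)
Lemma ball_average_bounds : exists2 La : R, 0 < La &
  forall s h v, 0 < s -> ri_set X h -> (forall x, 0 <= h x) ->
  measurable_fun setT v -> (forall x, 0 <= v x) ->
  {ae mu, forall x, v x <= h x + average mu (ball x s) h} ->
  (ri_set X v -> ri_norm X v <= La * ri_norm X h) /\
  forall la : R, 0 <= la ->
    (\int[mu]_x (Num.max (v x - la) 0)%:E <=
     \int[mu]_x (Num.max (La * h x - la) 0)%:E)%E.
Proof.
have [La La0 maj] := ball_average_majorant; exists La => //.
move=> s h v s0 Xh h0 mv v0 vh.
have [u [W [[mW ndW covW] Xu u0 hu exu]]] := maj s h s0 Xh h0.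
have [t0 ndt cvt] := truncated_cvg v0 ndW covW.
have mt n := measurable_truncated (mW n) mv.
have tu n : {ae mu, forall x, truncated W v n x <= La * u n x}.
  apply: filterS vh => x vx; rewrite /truncated.
  case: ifP => [/set_mem Wx|_]; last by rewrite mulr_ge0// ltW.
  by rewrite (le_trans vx)// hu.
split=> [Xv|la la0].
  apply: (ri_monotone_limit Xv mt t0 ndt cvt) => n.
  have [Xun nun] := Xu n.
  have [|Xt nt] := ri_ideal (ri_setZ La Xun) (mt n).
    by apply: filterS (tu n) => x; rewrite !ger0_norm// mulr_ge0// ltW.
  split=> //; rewrite (le_trans nt)// ri_normZ// gtr0_norm//.
  by rewrite ler_wpM2l// ltW.
have mex (k : T -> R) (l : R) : measurable_fun setT k ->
    measurable_fun setT (fun x => Num.max (k x - l) 0).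
  by move=> mk; apply: measurable_maxr => //; exact: measurable_funB.
have maxge0 (r : R) : 0 <= Num.max r 0 by rewrite le_max lexx orbT.
have scale (k : T -> R) : measurable_fun setT k ->
    (\int[mu]_x (Num.max (La * k x - la) 0)%:E =
     La%:E * \int[mu]_x (Num.max (k x - la / La) 0)%:E)%E.
  move=> mk; rewrite -ge0_integralZl//; last 3 first.
  - exact/measurable_EFinP/mex.
  - by move=> x _; rewrite lee_fin.
  - by rewrite lee_fin ltW.
  apply: eq_integral => x _; rewrite -EFinM maxr_pMr; last exact: ltW.
  by rewrite mulr0 mulrBr [La * (la / La)]mulrC divfK// gt_eqF.
have [tp0 ndtp cvtp] := @truncated_cvg W (fun x => Num.max (v x - la) 0)
  (fun x => maxge0 _) ndW covW.
have cvi := @cvg_integral_nondecreasing _ _ _ mu setT _ _ measurableT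
  (fun n => measurable_truncated (mW n) (mex v la mv)) tp0 ndtp cvtp.
rewrite -(cvg_lim _ cvi)//; apply: lime_le; first by apply/cvg_ex; eexists; exact: cvi.
apply: nearW => n.
apply: (@le_trans _ _ (\int[mu]_x (Num.max (La * u n x - la) 0)%:E)%E).
  apply: ae_ge0_le_integral => //.
  - by move=> x _; rewrite lee_fin.
  - exact/measurable_EFinP/measurable_truncated/mex.
  - by move=> x _; rewrite lee_fin.
  - exact/measurable_EFinP/mex/(ri_meas (ri_setZ La (Xu n).1)).
  - apply: filterS (tu n) => x; rewrite /truncated => H _; rewrite lee_fin.
    case: ifP H => // _ H; rewrite ge_max maxge0 andbT.
    by rewrite le_max lerD2r H.
rewrite !scale//; [|exact: ri_meas Xh|exact: ri_meas (Xu n).1].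
apply: lee_wpmul2l; first by rewrite lee_fin ltW.
by apply: exu; rewrite divr_ge0// ltW.
Qed.

End ball_averages.

(** * Layer cake formula and submajorization *)

Section layer_cake.
Context {R : realType}.
Local Notation leb := (@lebesgue_measure R).
Local Open Scope ereal_scope.

(** Levels range over the closed half-line, arguments of a rearrangement over the open one. *)
Lemma lebesgue_subgraph b (y : \bar R) : 0 <= y ->
  leb [set r : R | (0 < r ?<= if b)%R /\ r%:E < y] = y.
Proof.
case: y => [y|_|//].
  rewrite lee_fin => y0.
  rewrite (_ : [set r | _] = [set` Interval (BSide b 0%R) (BLeft y)]); last first.
    by apply/seteqP; split=> r /=; rewrite in_itv/= lte_fin; [case=> -> ->|move=> /andP].
  rewrite lebesgue_measure_itv/= lte_fin; case: ltgtP y0 => // [y0 _|<- _//].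
  by rewrite EFinN sube0.
rewrite (_ : [set r | _] = [set` Interval (BSide b 0%R) +oo%O]); last first.
  by apply/seteqP; split=> r /=; rewrite in_itv/= andbT ltry; [case|].
by rewrite lebesgue_measure_itv/= ltry sube0.
Qed.

(** Tonelli theorem for the indicator of the subgraph of [w]. *)
Lemma layer_cake d (T : measurableType d) (nu : {sigma_finite_measure set T -> \bar R})
    (w : T -> \bar R) : measurable_fun setT w -> (forall x, 0 <= w x) ->
  \int[nu]_x w x = \int[leb]_(r in `[0%R, +oo[) nu [set x | r%:E < w x].
Proof.
move=> mw w0.
pose A : set (T * measurableTypeR R) := [set z | (0 <= z.2)%R /\ z.2%:E < w z.1].
have mA : measurable A.
  have -> : A = [set z | (0 <= z.2)%R] `&` [set z | z.2%:E < w z.1] by [].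
  apply: measurableI.
    by apply: measurable_ler_set; [exact: measurable_cst|exact: measurable_snd].
  rewrite -[X in measurable X]setTI; apply: measurable_lte => //.
    apply/measurable_EFinP; exact: measurable_snd.
  exact: (measurableT_comp mw measurable_fst).
have := indic_fubini_tonelli nu leb mA.
rewrite indic_fubini_tonelli_FE// indic_fubini_tonelli_GE// => E.
transitivity (\int[nu]_x ((leb \o xsection A) x)).
  apply: eq_integral => x _ /=; rewrite -[LHS](lebesgue_subgraph true (w0 x)).
  by congr (leb _); apply/seteqP; split=> r; rewrite /xsection /= inE.
rewrite E [RHS]integral_mkcond; apply: eq_integral => r _ /=.
rewrite patchE; case: ifPn => [|/negP] r0.
  congr (nu _); move: r0; rewrite inE /= in_itv/= andbT => r0.
  by apply/seteqP; split=> x; rewrite /ysection /= inE /A/= => // -[].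
rewrite (_ : ysection _ _ = set0) ?measure0//.
rewrite -subset0 => x; rewrite /ysection /= inE => -[/= r0' _]; apply: r0.
by rewrite inE /= in_itv/= andbT.
Qed.

End layer_cake.

Section sigma_finite_copy.
Context {d : measure_display} {T : measurableType d} {R : realType}.
Variable mu : {measure set T -> \bar R}.

(** The same measure, under a name that carries the sigma-finiteness proof for
    instance resolution. *)
Definition sigma_finite_copy (sf : sigma_finite setT mu) : set T -> \bar R := mu.

HB.instance Definition _ (sf : sigma_finite setT mu) :=
  Measure.copy (sigma_finite_copy sf) mu.
HB.instance Definition _ (sf : sigma_finite setT mu) :=
  Measure_isSigmaFinite.Build d T R (sigma_finite_copy sf) sf.

End sigma_finite_copy.

Section rearrangement.
Context {d : measure_display} {T : measurableType d} {R : realType}.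
Variable mu : {measure set T -> \bar R}.
Implicit Types (v w : T -> R) (s r : R).
Local Notation leb := (@lebesgue_measure R).

Lemma rearr_ge0 w r : (0 <= rearr mu w r)%E.
Proof. by apply/ereal_infP => _ [s [s0 _] <-]; rewrite lee_fin. Qed.

Lemma rearr_le w r s : 0 <= s -> (mu [set x | (s < `|w x|)%R] <= r%:E)%E ->
  (rearr mu w r <= s%:E)%E.
Proof. by move=> s0 sr; apply: ereal_inf_lbound; exists s. Qed.

Lemma measurable_level w s : measurable_fun setT w ->
  measurable [set x | s < `|w x|].
Proof.
by move=> mw; apply: measurable_ltr_set => //; exact: measurableT_comp.
Qed.

(** The distribution function is right continuous, so the infimum defining the
    rearrangement is attained. *)
Lemma lt_rearr w s r : measurable_fun setT w -> 0 <= s ->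
  (s%:E < rearr mu w r)%E <-> (r%:E < mu [set x | (s < `|w x|)%R])%E.
Proof.
move=> mw s0; split=> [|rs].
  by rewrite !ltNge; apply: contra => /(rearr_le s0).
pose L n := [set x | (s + n.+1%:R^-1 < `|w x|)%R].
have mL n : measurable (L n) by exact: measurable_level.
have eL : [set x | s < `|w x|] = \bigcup_n L n.
  apply/seteqP; split=> [x /= sw|x [n _ /=]]; last exact/le_lt_trans/ltW/(ltr_pwDr _ (lexx _)).
  have [n] := ltr_add_invr sw; by exists n.
have ndL : nondecreasing_seq L.
  move=> n m nm; apply/subsetPset => x; apply: le_lt_trans.
  by rewrite lerD2l lef_pV2 ?posrE ?ltr0n// ler_nat.
have mUL : measurable (\bigcup_n L n) by exact: bigcup_measurable.
have cv := @nondecreasing_cvg_mu _ _ _ mu _ mL mUL ndL.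
have [n rn] : exists n, (r%:E < mu (L n))%E.
  apply: contrapT => /forallNP H.
  have : (mu (\bigcup_n L n) <= r%:E)%E.
    rewrite -(cvg_lim _ cv)//; apply: lime_le; first by apply/cvg_ex; eexists; exact: cv.
    by apply: nearW => n /=; have /negP := H n; rewrite -leNgt.
  by rewrite -eL leNgt rs.
apply: (@lt_le_trans _ _ (s + n.+1%:R^-1)%:E).
  by rewrite lte_fin ltrDl.
apply/ereal_infP => _ [t [t0 tr] <-]; rewrite lee_fin leNgt; apply/negP => ts.
move: rn; rewrite ltNge => /negP; apply; apply: le_trans tr.
apply: le_measure; rewrite ?inE//; first exact: measurable_level.
by move=> x; apply: lt_trans.
Qed.

Lemma nonincreasing_rearr w r s : r <= s -> (rearr mu w s <= rearr mu w r)%E.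
Proof.
move=> rs; apply: ereal_inf_le_tmp => _ [t [t0 tr] <-]; exists t => //.
by split=> //; rewrite (le_trans tr)// lee_fin.
Qed.

Local Notation rearr0 w := (fun r : R => if 0 < r then rearr mu w r else 0%E).

Lemma measurable_rearr w : measurable_fun setT w ->
  measurable_fun [set: measurableTypeR R] (rearr0 w : measurableTypeR R -> \bar R).
Proof.
move=> mw; apply: (measurability _ (ErealGenOInfty.measurableE R)).
move=> _ [_ [s ->] <-]; rewrite setTI.
have [s0|s0] := ltP s 0.
  rewrite (_ : _ @^-1` _ = setT)//; apply/seteqP; split=> // r _ /=.
  rewrite in_itv/= andbT; case: ifP => _; last by rewrite lte_fin.
  by rewrite (lt_le_trans _ (rearr_ge0 _ _))// lte_fin.
rewrite (_ : _ @^-1` _ = [set r | 0 < r] `&` [set r : measurableTypeR R |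
    (r%:E < mu [set x | (s < `|w x|)%R])%E]); last first.
  apply/seteqP; split=> r /=; rewrite in_itv/= andbT.
    by case: ifPn => [r0 /lt_rearr|_]; [move=> /(_ mw s0)|rewrite lte_fin ltNge s0].
  by move=> [r0]; rewrite r0 => /lt_rearr; apply.
apply: measurableI.
  by apply: measurable_ltr_set; [exact: measurable_cst|exact: measurable_id].
rewrite -[X in measurable X]setTI; apply: measurable_lte => //.
Qed.

Hypothesis mu_sfin : sigma_finite setT mu.

(** Both sides are the integral of the distribution function of [w]. *)
Lemma integral_rearr w : measurable_fun setT w ->
  (\int[leb]_(r in `]0%R, +oo[%classic) rearr mu w r = \int[mu]_x `|w x|%:E)%E.
Proof.
move=> mw.
have mrw := measurable_rearr mw.
transitivity (\int[leb]_r rearr0 w r)%E.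
  rewrite integral_mkcond; apply: eq_integral => r _.
  rewrite patchE; case: ifPn => [|/negP] r0.
    by rewrite inE /= in_itv/= andbT in r0; rewrite r0.
  by case: ifP => // r0'; case: r0; rewrite inE /= in_itv/= r0'.
rewrite (layer_cake leb mrw); last first.
  by move=> r; case: ifP => // _; exact: rearr_ge0.
have mw' : measurable_fun setT (fun x => `|w x|%:E).
  exact/measurable_EFinP/measurableT_comp.
have := @layer_cake _ _ _ (sigma_finite_copy mu_sfin) _ mw' (fun x => _).
move=> -> //; apply: eq_integral => s; rewrite inE /= in_itv/= andbT => s0.
rewrite /= -[RHS](lebesgue_subgraph false (measure_ge0 mu _)); congr (leb _).
have wE : [set x | s%:E < `|w x|%:E]%E = [set x | s < `|w x|].
  by apply/seteqP; split=> x /=; rewrite lte_fin.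
apply/seteqP; split=> r /=; rewrite wE.
  by case: ifPn => [r0 /lt_rearr H|_]; [split=> //; exact: H|rewrite lte_fin ltNge s0].
by move=> [r0]; rewrite r0 => H; exact/lt_rearr.
Qed.

Local Notation excess w la := (fun x => Num.max (w x - la) 0).

Lemma excess_ge0 w (la : R) x : 0 <= excess w la x.
Proof. by rewrite le_max lexx orbT. Qed.

Lemma measurable_excess w (la : R) : measurable_fun setT w ->
  measurable_fun setT (excess w la).
Proof. by move=> mw; apply: measurable_maxr => //; exact: measurable_funB. Qed.

Lemma level_excess w (la t : R) : 0 <= la -> 0 <= t -> (forall x, 0 <= w x) ->
  [set x | t < `|excess w la x|] = [set x | la + t < `|w x|].
Proof.
move=> la0 t0 w0; apply/seteqP; split=> x /=; rewrite !ger0_norm ?excess_ge0//.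
  by rewrite lt_max [t < 0]ltNge t0 orbF ltrBrDl.
by rewrite lt_max -ltrBrDl => ->.
Qed.

(** [w <= la + (w - la)^+]. *)
Lemma rearr_le_excess w (la r : R) : 0 <= la -> (forall x, 0 <= w x) ->
  (rearr mu w r <= la%:E + rearr mu (excess w la) r)%E.
Proof.
move=> la0 w0; rewrite -leeBlDl//; apply/ereal_infP => _ [t [t0 tr] <-].
rewrite leeBlDl// -EFinD; apply: rearr_le; first exact: addr_ge0.
by rewrite -level_excess.
Qed.

(** A level admissible for [w] at [r <= s] is at least [la], and lowered by [la] it
    is admissible for the excess. *)
Lemma le_rearr_excess w (la s r : R) : 0 <= la -> (forall x, 0 <= w x) ->
  rearr mu w s = la%:E -> r <= s ->
  (la%:E + rearr mu (excess w la) r <= rearr mu w r)%E.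
Proof.
move=> la0 w0 sla rs; apply/ereal_infP => _ [t [t0 tr] <-].
have lat : la <= t.
  rewrite -lee_fin -sla; apply: rearr_le => //.
  by rewrite (le_trans tr)// lee_fin.
rewrite -leeBrDl// -EFinB; apply: rearr_le; first by rewrite subr_ge0.
by rewrite level_excess ?subr_ge0// addrC subrK.
Qed.

(** The integral of the rearrangement of [w] over [(0, s)] is the minimum over [la] of
    [s la + int (w - la)^+], attained at [la = rearr w s]. *)
Lemma submajorization_excess v w : measurable_fun setT v -> measurable_fun setT w ->
  (forall x, 0 <= v x) -> (forall x, 0 <= w x) ->
  (forall la, 0 <= la -> (\int[mu]_x (excess v la x)%:E <=
                          \int[mu]_x (excess w la x)%:E)%E) ->
  forall s, 0 < s ->
  (\int[leb]_(r in `]0%R, s[%classic) rearr mu v r <=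
   \int[leb]_(r in `]0%R, s[%classic) rearr mu w r)%E.
Proof.
move=> mv mw v0 w0 vw s s0.
have mr (k : T -> R) (A : set R) : measurable_fun setT k -> A `<=` [set r | 0 < r] ->
    measurable A -> measurable_fun (A : set (measurableTypeR R)) (rearr mu k).
  move=> mk A0 mA; apply: (eq_measurable_fun (rearr0 k)); last first.
    exact: measurable_funTS (measurable_rearr mk).
  by move=> r /set_mem /A0 /= ->.
have sub0 : `]0, s[%classic `<=` [set r : R | 0 < r].
  by move=> r /=; rewrite in_itv/= => /andP[].
have suby : `]0, +oo[%classic `<=` [set r : R | 0 < r].
  by move=> r /=; rewrite in_itv/= andbT.
have [woo|wfin] := eqVneq (rearr mu w s) +oo%E.
  rewrite [leRHS](_ : _ = +oo%E) ?leey//.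
  rewrite (eq_integral (cst +oo%E)); last first.
    move=> r; rewrite inE /= in_itv/= => /andP[r0 rs].
    by apply/eqP; rewrite -leye_eq -woo nonincreasing_rearr// ltW.
  have lebs : leb `]0, s[%classic = s%:E.
    by rewrite lebesgue_measure_itv/= lte_fin s0 EFinN sube0.
  rewrite integral_cst// [X in (_ * X)%E](_ : _ = s%:E)//.
  by rewrite gt0_mulye// lte_fin.
have [la laE] : exists la, rearr mu w s = la%:E.
  exists (fine (rearr mu w s)); rewrite fineK// ge0_fin_numE ?rearr_ge0//.
  by rewrite ltey.
have la0 : 0 <= la by rewrite -lee_fin -laE rearr_ge0.
have mev := measurable_excess la mv; have mew := measurable_excess la mw.
have upper : (\int[leb]_(r in `]0%R, s[%classic) rearr mu v r <=
    la%:E * leb `]0%R, s[%classic + \int[mu]_x (excess v la x)%:E)%E.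
  rewrite -integral_cst//.
  have -> : (\int[mu]_x (excess v la x)%:E =
      \int[leb]_(r in `]0%R, +oo[%classic) rearr mu (excess v la) r)%E.
    rewrite integral_rearr//; apply: eq_integral => x _.
    by rewrite ger0_norm// excess_ge0.
  apply: (@le_trans _ _ (\int[leb]_(r in `]0%R, s[%classic)
      (cst la%:E r + rearr mu (excess v la) r))%E).
    apply: ge0_le_integral => //.
    - by move=> r _; exact: rearr_ge0.
    - exact: mr.
    - by apply: emeasurable_funD => //; exact: mr.
    - by move=> r _; exact: rearr_le_excess.
  rewrite ge0_integralD//; last 2 first.
  - by move=> r _; exact: rearr_ge0.
  - exact: mr.
  apply: leeD => //; apply: ge0_subset_integral => //.
  - exact: mr.
  - by move=> r _; exact: rearr_ge0.
  - by move=> r /=; rewrite !in_itv/= => /andP[->].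
have lower : (la%:E * leb `]0%R, s[%classic + \int[mu]_x (excess w la x)%:E <=
    \int[leb]_(r in `]0%R, s[%classic) rearr mu w r)%E.
  rewrite -integral_cst//.
  have -> : (\int[mu]_x (excess w la x)%:E =
      \int[leb]_(r in `]0%R, s[%classic) rearr mu (excess w la) r)%E.
    transitivity (\int[leb]_(r in `]0%R, +oo[%classic) rearr mu (excess w la) r)%E.
      rewrite integral_rearr//; apply: eq_integral => x _.
      by rewrite ger0_norm// excess_ge0.
    rewrite integral_mkcond [RHS]integral_mkcond; apply: eq_integral => r _.
    rewrite !patchE; have [rs|rs] := ltP r s.
      by congr (if _ then _ else _); apply/idP/idP; rewrite !inE /= !in_itv/= rs.
    rewrite [in RHS]memNset; last by rewrite /= in_itv/= [r < s]ltNge rs andbF.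
    case: ifP => // _; apply/eqP; rewrite eq_le rearr_ge0 andbT.
    apply: rearr_le => //; rewrite level_excess// addr0.
    apply: (@le_trans _ _ s%:E); last by rewrite lee_fin.
    rewrite leNgt; apply/negP => /(lt_rearr s mw la0).
    by rewrite laE ltxx.
  rewrite -ge0_integralD//; last 2 first.
  - by move=> r _; exact: rearr_ge0.
  - exact: mr.
  apply: ge0_le_integral => //.
  - by move=> r _; rewrite adde_ge0// rearr_ge0.
  - by apply: emeasurable_funD => //; exact: mr.
  - exact: mr.
  - move=> r; rewrite /= in_itv/= => /andP[r0 rs].
    exact: le_rearr_excess laE (ltW rs).
by rewrite (le_trans upper)// (le_trans _ lower)// leeD2l// vw.
Qed.

End rearrangement.

(** * Measurability of the modulus of smoothness *)

Section nabla_measurability.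
Context {d : measure_display} {R : realType} {T : borelMetricType d R}.
Variable mu : {measure set T -> \bar R}.
Hypothesis mu_doubling : doubling mu.

Lemma doubling_sigma_finite : sigma_finite setT mu.
Proof.
have [C dbl] := exists_doubling_bound mu_doubling.
have [N net] := exists_net mu_doubling dbl.
have [c [cov _]] := net 1 ltr01.
exists (fun k => oball (c k) 1).
  by apply/esym; rewrite -subTset => x _; have [k] := cov x; exists k.
by move=> k; split; [exact: measurable_oball|exact: oball_lty].
Qed.

(** Countably many products of balls around the points of nets of mesh [1 / (j + 1)]
    exhaust the set. *)
Lemma measurable_near_diagonal (r : R) :
  measurable [set z : T * T | mdist z.1 z.2 < r].
Proof.
have [C dbl] := exists_doubling_bound mu_doubling.
have [N net] := exists_net mu_doubling dbl.
pose sj (j : nat) : R := j.+1%:R^-1.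
have sj0 j : 0 < sj j by rewrite invr_gt0.
have /choice[c /all_and2[cov _]] j := net (sj j) (sj0 j).
rewrite (_ : [set z | _] = \bigcup_j \bigcup_k
    (oball (c j k) (sj j) `*` oball (c j k) (r - sj j))).
  apply: bigcup_measurable => j _; apply: bigcup_measurable => k _.
  by apply: measurableX; exact: measurable_oball.
apply/seteqP; split=> [[x y] /= xy|[x y] [j _ [k _ []]] /=].
  have d0 : 0 < (r - mdist x y) / 2 by rewrite divr_gt0// subr_gt0.
  have [j] := ltr_add_invr d0; rewrite add0r -/(sj j) => jxy.
  have [k xk] := cov j x; exists j => //; exists k => //; split=> //=.
  case: (c j k) xk => //= a /ballE ax; apply/ballE.
  by have := metric_triangle a x y; move: jxy ax; lra.
case: (c j k) => //= a /ballE ax /ballE ay.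
by have := metric_triangle x a y; rewrite (metric_sym x a); move: ax ay; lra.
Qed.

Lemma measurable_ball_integral (r : R) (k : T * T -> R) :
  measurable_fun setT k -> (forall z, 0 <= k z) ->
  measurable_fun setT (fun x => (\int[mu]_(y in ball x r) (k (x, y))%:E)%E).
Proof.
move=> mk k0.
pose A := [set z : T * T | mdist z.1 z.2 < r].
have mA : measurable A by exact: measurable_near_diagonal.
pose K (z : T * T) := ((\1_A z) * k z)%:E.
have mK : measurable_fun setT K.
  apply/measurable_EFinP; apply: measurable_funM => //; exact: measurable_indic.
have K0 z : (0 <= K z)%E by rewrite lee_fin mulr_ge0// indicE.
have := @measurable_fun_fubini_tonelli_F _ _ _ _ _
  (sigma_finite_copy doubling_sigma_finite) K mK.
move=> /(_ K0); apply: eq_measurable_fun => x _.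
rewrite /fubini_F [RHS]integral_mkcond; apply: eq_integral => y _.
rewrite /K patchE indicE /A; case: ifPn => [/set_mem/ballE xy|/negP xy].
  by rewrite mem_set// mul1r.
by rewrite memNset ?mul0r// => xy'; apply: xy; rewrite inE; exact/ballE.
Qed.

Lemma measurable_nabla (a r : R) (f : T -> R) : measurable_fun setT f ->
  measurable_fun setT (nabla mu a r f).
Proof.
move=> mf.
apply: (measurableT_comp (measurable_powR a^-1)).
apply: measurable_funM.
  apply: (measurableT_comp (fine_measurable measurableT)).
  apply: (measurable_ball_integral r (k := fun z => `|f z.1 - f z.2| `^ a)).
    apply: (measurableT_comp (measurable_powR a)); apply: measurableT_comp => //.
    apply: measurable_funB; first exact: (measurableT_comp mf measurable_fst).
    exact: (measurableT_comp mf measurable_snd).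
  by move=> z; exact: powR_ge0.
apply: (eq_measurable_fun (fun x => fine (mu (ball x r)) `^ (-1))).
  by move=> x _; rewrite powR_inv1// fine_ge0.
apply: (measurableT_comp (measurable_powR (-1))).
apply: (measurableT_comp (fine_measurable measurableT)).
apply: (eq_measurable_fun (fun x => (\int[mu]_(y in ball x r) 1%:E)%E)).
  move=> x _; rewrite integral_cst ?mul1e//; exact: measurable_metric_ball.
exact: (measurable_ball_integral r (k := cst 1)).
Qed.

End nabla_measurability.

(** * Powers of functions and oscillation over balls *)

Section powers_of_functions.
Context {d : measure_display} {T : measurableType d} {R : realType}.
Variables (mu : {measure set T -> \bar R}) (a : R).
Hypotheses (a_gt0 : 0 < a) (a_le1 : a <= 1).
Implicit Types f : T -> R.

Lemma L_plus_Linfty_measurable f : L_plus_Linfty mu a f -> measurable_fun setT f.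
Proof. by case=> f0 [f1 [m0 m1 _ _ ->]]; exact: measurable_funD. Qed.

Lemma finite_norm_powR f : finite_norm mu a%:E f ->
  (\int[mu]_x (`|f x| `^ a)%:E < +oo)%E.
Proof.
rewrite /finite_norm unlock /=; have a0 : a^-1 != 0 by rewrite invr_neq0 ?gt_eqF.
by move/(lty_poweRy a0).
Qed.

Lemma powR_finite_norm f : (\int[mu]_x (`|f x| `^ a)%:E < +oo)%E ->
  finite_norm mu a%:E f.
Proof. by move=> fa; rewrite /finite_norm unlock; exact: poweR_lty. Qed.

Lemma esssup_finite_norm f (M : R) : {ae mu, forall x, `|f x| <= M} ->
  finite_norm mu +oo%E f.
Proof.
move=> fM; rewrite /finite_norm unlock /=; case: ifP => // _.
apply: (@le_lt_trans _ _ M%:E); last by rewrite ltry.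
by apply/ess_supP; apply: filterS fM => x; rewrite /= lee_fin.
Qed.

Lemma finite_norm_esssup f : finite_norm mu +oo%E f ->
  exists2 M : R, 0 <= M & {ae mu, forall x, `|f x| <= M}.
Proof.
rewrite /finite_norm unlock /=; case: ifPn => [_|]; last first.
  rewrite measure_gt0 negbK => /eqP mu0 _; exists 0 => //.
  by exists setT; split.
have := ess_sup_ge mu (abse \o (EFin \o f)).
case: ess_sup => [r| |] //= H _.
- exists (Num.max r 0); first by rewrite le_max lexx orbT.
  by apply: filterS H => x; rewrite lee_fin le_max => ->.
- by exists 0 => //; apply: filterS H => x; rewrite leeNy_eq.
Qed.

Lemma powR_dist_le (u v w : R) : `|u - w| `^ a <= `|u - v| `^ a + `|v - w| `^ a.
Proof.
rewrite (le_trans _ (powR_subadditive a_gt0 a_le1 _ _))//.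
by apply: ge0_ler_powR; rewrite ?nnegrE ?addr_ge0 ?(ltW a_gt0)//; exact: ler_distD.
Qed.

Lemma powR_normD_le (u v : R) : `|u + v| `^ a <= `|u| `^ a + `|v| `^ a.
Proof. by have := powR_dist_le u 0 (- v); rewrite subr0 opprK add0r. Qed.

Lemma measurable_powR_norm f : measurable_fun setT f ->
  measurable_fun setT (fun x => `|f x| `^ a).
Proof.
by move=> mf; apply: (measurableT_comp (measurable_powR a)); exact: measurableT_comp.
Qed.

End powers_of_functions.

Section pointwise_oscillation.
Context {d : measure_display} {R : realType} {T : borelMetricType d R}.
Variable mu : {measure set T -> \bar R}.
Hypothesis mu_doubling : doubling mu.
Variable a : R.
Hypotheses (a_gt0 : 0 < a) (a_le1 : a <= 1).
Implicit Types (f : T -> R) (x y : T) (s : R).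

Lemma locally_powR_integrable f x s : L_plus_Linfty mu a f -> 0 < s ->
  (\int[mu]_(z in ball x s) (`|f z| `^ a)%:E < +oo)%E.
Proof.
move=> [f0 [f1 [m0 m1 /(finite_norm_powR a_gt0) f0a /finite_norm_esssup[M M0 f1M] ->]]] s0.
have mB := measurable_metric_ball x s.
have Boo := ball_lty mu_doubling x s0.
apply: (@le_lt_trans _ _ (\int[mu]_(z in ball x s)
    ((`|f0 z| `^ a)%:E + cst (M `^ a)%:E z))%E).
  apply: ae_ge0_le_integral => //.
  - apply/measurable_EFinP/measurable_funTS/measurable_powR_norm.
    exact: measurable_funD.
  - by move=> z _; rewrite -EFinD lee_fin addr_ge0 ?powR_ge0.
  - apply: emeasurable_funD => //.
    exact/measurable_EFinP/measurable_funTS/measurable_powR_norm.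
  - apply: filterS f1M => z f1z _; rewrite -EFinD lee_fin.
    rewrite (le_trans (powR_normD_le a_gt0 a_le1 _ _))// lerD2l.
    by apply: ge0_ler_powR; rewrite ?nnegrE ?(ltW a_gt0).
rewrite ge0_integralD//; last 2 first.
- exact/measurable_EFinP/measurable_funTS/measurable_powR_norm.
- by move=> z _; rewrite lee_fin powR_ge0.
rewrite integral_cst// lte_add_pinfty//.
  apply: le_lt_trans f0a; apply: ge0_subset_integral => //.
  - exact/measurable_EFinP/measurable_powR_norm.
by rewrite lte_mul_pinfty// ?lee_fin ?powR_ge0.
Qed.

Lemma ball_osc_integrable f x y s : L_plus_Linfty mu a f -> 0 < s ->
  (\int[mu]_(z in ball y s) (`|f x - f z| `^ a)%:E < +oo)%E.
Proof.
move=> Lf s0; have mf := L_plus_Linfty_measurable Lf.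
have mB := measurable_metric_ball y s.
have Boo := ball_lty mu_doubling y s0.
apply: (@le_lt_trans _ _ (\int[mu]_(z in ball y s)
    ((`|f z| `^ a)%:E + cst (`|f x| `^ a)%:E z))%E).
  apply: ge0_le_integral => //.
  - apply/measurable_EFinP/measurable_funTS/measurable_powR_norm.
    exact: measurable_funB.
  - apply: emeasurable_funD => //.
    exact/measurable_EFinP/measurable_funTS/measurable_powR_norm.
  - move=> z _; rewrite -EFinD lee_fin addrC.
    by rewrite (le_trans (powR_normD_le a_gt0 a_le1 _ _))// normrN.
rewrite ge0_integralD//; last 2 first.
- exact/measurable_EFinP/measurable_funTS/measurable_powR_norm.
- by move=> z _; rewrite lee_fin powR_ge0.
rewrite integral_cst// lte_add_pinfty//; first exact: locally_powR_integrable.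
by rewrite lte_mul_pinfty// ?lee_fin ?powR_ge0.
Qed.

Lemma nabla_powR f x s :
  nabla mu a s f x `^ a = average mu (ball x s) (fun y => `|f x - f y| `^ a).
Proof.
rewrite /nabla powRVK// ?gt_eqF//; apply: divr_ge0; last exact: fine_ge0.
by apply: Rintegral_ge0 => y _; exact: powR_ge0.
Qed.

(** Average the triangle inequality through [f z] over [z] in [ball x s]; this ball
    has measure comparable with those of [ball x (2 * s)] and [ball y (2 * s)],
    which contain it. *)
Lemma nabla_oscillation : exists2 ka : R, 0 < ka & forall f s x y,
  L_plus_Linfty mu a f -> 0 < s -> mdist x y < s ->
  `|f x - f y| <= ka * (nabla mu a (2 * s) f x + nabla mu a (2 * s) f y).
Proof.
have [C dbl] := exists_doubling_bound mu_doubling.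
have C1 := dbl.1; have C0 : 0 < C by rewrite (lt_trans _ C1).
pose K := C ^+ 2; have K0 : 0 < K by rewrite exprn_gt0.
exists (2 `^ a^-1 * K `^ a^-1); first by rewrite mulr_gt0 ?powR_gt0.
move=> f s x y Lf s0 xy; have mf := L_plus_Linfty_measurable Lf.
have s20 : 0 < 2 * s by rewrite mulr_gt0.
pose N x := average mu (ball x (2 * s)) (fun y => `|f x - f y| `^ a).
have N0 z : 0 <= N z by apply: average_ge0 => w; exact: powR_ge0.
have m0 := fine_ball_gt0 mu_doubling x s0.
have mosc z (A : set T) : measurable_fun A (fun w => (`|f z - f w| `^ a)%:E).
  apply/measurable_EFinP/measurable_funTS/measurable_powR_norm.
  exact: measurable_funB.
have osc0 z w : (0 <= (`|f z - f w| `^ a)%:E :> \bar R)%E by rewrite lee_fin powR_ge0.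
have piece z : mdist x z < s ->
    (\int[mu]_(w in ball x s) (`|f z - f w| `^ a)%:E <=
      (K * N z * fine (mu (ball x s)))%:E)%E.
  move=> xz; have mz := fine_ball_gt0 mu_doubling z s20.
  apply: (@le_trans _ _ (\int[mu]_(w in ball z (2 * s)) (`|f z - f w| `^ a)%:E)%E).
    apply: ge0_subset_integral => //; [exact: measurable_metric_ball..|].
    by apply: subset_ball_add; rewrite metric_sym; lra.
  have fin : (\int[mu]_(w in ball z (2 * s)) (`|f z - f w| `^ a)%:E)%E \is a fin_num.
    rewrite ge0_fin_numE; first exact: ball_osc_integrable.
    by apply: integral_EFin_ge0 => w; exact: powR_ge0.
  rewrite -(fineK fin) lee_fin.
  rewrite (_ : fine _ = N z * fine (mu (ball z (2 * s)))); last first.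
    by rewrite /N /average divfK// gt_eqF.
  rewrite [leLHS]mulrC [leRHS]mulrAC; apply: ler_wpM2r => //.
  rewrite -lee_fin EFinM !fineK ?(ball_fin mu_doubling)//.
  by apply: dbl.2 => //; rewrite metric_sym expr2; lra.
have key : `|f x - f y| `^ a <= K * (N x + N y).
  rewrite -(ler_pM2r m0) -lee_fin EFinM fineK ?(ball_fin mu_doubling)//.
  rewrite -integral_cst; last exact: measurable_metric_ball.
  apply: (@le_trans _ _ (\int[mu]_(z in ball x s)
     ((`|f x - f z| `^ a)%:E + (`|f y - f z| `^ a)%:E))%E).
    apply: ge0_le_integral => //; first exact: measurable_metric_ball.
    - by move=> z _; exact: osc0.
    - by apply: emeasurable_funD; exact: mosc.
    - move=> z _; rewrite -EFinD lee_fin (distrC (f y)).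
      exact: (powR_dist_le a_gt0 a_le1).
  rewrite ge0_integralD//; last exact: measurable_metric_ball.
  rewrite mulrDr mulrDl EFinD; apply: leeD; apply: piece => //.
  by rewrite mdistxx.
have := @ge0_ler_powR R a^-1 _ _ _ _ _ key.
rewrite powRK ?gt_eqF//; rewrite invr_ge0 (ltW a_gt0) !nnegrE powR_ge0.
rewrite mulr_ge0 ?addr_ge0 ?(ltW K0)// => /(_ isT isT isT) /le_trans; apply.
rewrite powRM ?addr_ge0 ?(ltW K0)//.
rewrite [X in _ <= X * _]mulrC -mulrA ler_pM2l ?powR_gt0//.
by apply: powR_addr_max => //; rewrite invr_gt0.
Qed.

End pointwise_oscillation.

(** * Regularization at a fixed scale *)

Section regularization.
Context {R : realType} {T : metricType R}.
Variables (f D : T -> R) (t : R).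
Hypothesis t_gt0 : 0 < t.
Hypothesis osc : forall x y, mdist x y < 12 * t -> `|f x - f y| <= D x + D y.

Let c (z : T) := sup [set f y - D y | y in [set y | mdist z y < 6 * t]].
Let K (z : T) := sup [set c z - c w | w in [set w | mdist z w < 3 * t]].
Let ramp (z x : T) := Num.max 0 (mdist x z / t - 1).
Let F (x : T) := [set c z - K z * ramp z x | z in [set z | mdist x z < 2 * t]].

Let c_close x z : mdist x z < 6 * t -> `|f x - c z| <= D x.
Proof.
move=> xz.
have ub : ubound [set f y - D y | y in [set y | mdist z y < 6 * t]] (f x + D x).
  move=> _ [y /= zy <-]; have := metric_triangle x z y.
  move=> xzy; have /osc : mdist x y < 12 * t by lra.
  by rewrite ler_norml => /andP[]; lra.
have mem : [set f y - D y | y in [set y | mdist z y < 6 * t]] (f x - D x).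
  by exists x => //=; rewrite metric_sym.
have hi : c z <= f x + D x by apply: ge_sup => //; exists (f x - D x).
have lo : f x - D x <= c z by apply: ub_le_sup => //; exists (f x + D x).
by rewrite ler_norml; apply/andP; split; lra.
Qed.

Let K_ub p z : mdist p z < 3 * t ->
  ubound [set c z - c w | w in [set w | mdist z w < 3 * t]] (2 * D p).
Proof.
move=> pz _ [w /= zw <-]; have pzw := metric_triangle p z w.
have /c_close : mdist p w < 6 * t by lra.
have /c_close : mdist p z < 6 * t by move: t_gt0; lra.
by rewrite !ler_norml => /andP[? ?] /andP[? ?]; lra.
Qed.

Let K_ge z w : mdist z w < 3 * t -> c z - c w <= K z.
Proof.
move=> zw; apply: ub_le_sup; last by exists w.
by exists (2 * D z); apply: K_ub; rewrite mdistxx mulr_gt0.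
Qed.

Let K_ge0 z : 0 <= K z.
Proof. by have := @K_ge z z; rewrite subrr mdistxx mulr_gt0//; exact. Qed.

Let K_le p z : mdist p z < 3 * t -> K z <= 2 * D p.
Proof.
move=> pz; apply: ge_sup; last exact: K_ub.
by exists (c z - c z); exists z => //=; rewrite mdistxx mulr_gt0.
Qed.

Let ramp_ge0 z x : 0 <= ramp z x.
Proof. by rewrite le_max lexx. Qed.

Let F_ub x : ubound (F x) (f x + D x).
Proof.
move=> _ [z /= xz <-]; have /c_close : mdist x z < 6 * t by move: t_gt0; lra.
rewrite ler_norml => /andP[H _]; have : 0 <= K z * ramp z x by rewrite mulr_ge0.
by lra.
Qed.

Let F_center x : F x (c x).
Proof.
exists x; first by rewrite /= mdistxx mulr_gt0.
by rewrite /ramp mdistxx mul0r sub0r (max_idPl _) ?mulr0 ?subr0// oppr_le0.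
Qed.

Let F_has_sup x : has_sup (F x).
Proof. by split; [exists (c x)|exists (f x + D x)]. Qed.

Let f1 x := sup (F x).

Let f1_ge x z : mdist x z < 2 * t -> c z - K z * ramp z x <= f1 x.
Proof. by move=> xz; apply: ub_le_sup; [case: (F_has_sup x)|exists z]. Qed.

Let f1_step p x y : mdist p x < t -> mdist x y < t ->
  f1 x <= f1 y + 2 * D p * (mdist x y / t).
Proof.
move=> px xy; apply: ge_sup; first by case: (F_has_sup x).
move=> _ [z /= xz <-].
have pxz := metric_triangle p x z; have yxz := metric_triangle y x z.
rewrite (metric_sym y x) in yxz.
have KD : K z <= 2 * D p by apply: K_le; lra.
have e0 : 0 <= mdist x y / t by rewrite divr_ge0// ?mdist_ge0// ltW.
have Ke : K z * (mdist x y / t) <= 2 * D p * (mdist x y / t) by rewrite ler_wpM2r.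
(* If [z] is too far from [y] to count in [f1 y], its ramp at [x] is nearly
   complete and its term is below [c y], up to the allowed error. *)
have [yz|yz] := ltP (mdist y z) (2 * t).
  have f1y := f1_ge yz.
  have Kr : K z * ramp z y <= K z * (ramp z x + mdist x y / t).
    apply: ler_wpM2l => //; rewrite {1}/ramp ge_max addr_ge0//= /ramp.
    have : mdist y z / t <= mdist x y / t + mdist x z / t.
      by rewrite -mulrDl ler_pM2r ?invr_gt0.
    have : mdist x z / t - 1 <= Num.max 0 (mdist x z / t - 1) by rewrite le_max lexx orbT.
    by lra.
  by rewrite mulrDr in Kr; lra.
have /c_close : mdist z y < 6 * t by rewrite metric_sym; lra.
have zy3 : mdist z y < 3 * t by rewrite metric_sym; lra.
have Kzy := K_ge zy3 => _.
have : K z * (1 - mdist x y / t) <= K z * ramp z x.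
  apply: ler_wpM2l => //; rewrite /ramp le_max; apply/orP; right.
  have : 2 <= (mdist x y + mdist x z) / t by rewrite ler_pdivlMr//; lra.
  by rewrite mulrDl; lra.
have : c y <= f1 y by apply: ub_le_sup; [case: (F_has_sup y)|exact: F_center].
by rewrite mulrBr mulr1; lra.
Qed.

(** Let [c z] be a point common to all intervals [[f y - D y, f y + D y]] with [y] in
    the ball of radius [6 t] around [z]; pairwise intersecting intervals have
    one, for instance the supremum of the left end points.  The function [f1 x]
    is the supremum of the [c z] over [z] at distance less than [2 t] from [x],
    lowered by a ramp that starts at distance [t] from [z] and whose height [K z]
    is large enough for the term of [z] to be below [c y] when [y] leaves the
    ball of radius [2 t].  So no term disappears abruptly, and the slopes
    [K z / t] are at most [2 D x / t]. *)
Lemma lipschitz_regularization : exists f1 : T -> R,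
  (forall x, `|f x - f1 x| <= D x) /\
  forall x y, mdist x y < t -> `|f1 x - f1 y| <= 2 * D x * (mdist x y / t).
Proof.
exists f1; split=> [x|x y xy].
  have lo : c x <= f1 x by apply: ub_le_sup; [case: (F_has_sup x)|exact: F_center].
  have hi : f1 x <= f x + D x by apply: ge_sup; [case: (F_has_sup x)|exact: F_ub].
  have /c_close : mdist x x < 6 * t by rewrite mdistxx mulr_gt0.
  by rewrite !ler_norml => /andP[? ?]; apply/andP; split; lra.
have xx : mdist x x < t by rewrite mdistxx.
have := f1_step xx xy; have := @f1_step x y x xy.
rewrite (metric_sym y x) => /(_ xy).
by rewrite ler_norml => H1 H2; apply/andP; split; lra.
Qed.

End regularization.

(** * Series and level sets in r.i. spaces *)

Section ri_series.
Context {d : measure_display} {T : measurableType d} {R : realType}.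
Variables (mu : {measure set T -> \bar R}) (X : ri_space mu).

Lemma ri_norm_sub_sym (f g : T -> R) : ri_set X f -> ri_set X g ->
  ri_set X (f \- g) /\ ri_norm X (f \- g) = ri_norm X (g \- f).
Proof.
move=> Xf Xg; have Xgf : ri_set X (g \- f).
  rewrite (_ : g \- f = g \+ (fun x => -1 * f x)).
    exact/ri_setD/ri_setZ.
  by apply/funext => x /=; rewrite mulN1r.
have -> : f \- g = (fun x => -1 * (g \- f) x).
  by apply/funext => x /=; rewrite mulN1r opprB.
by split; [exact: ri_setZ|rewrite ri_normZ// normrN1 mul1r].
Qed.

(** Completeness gives a limit in norm of the partial sums.  The positive part of
    the difference of a partial sum and the limit is dominated by the differences
    of all later partial sums and the limit, so it has norm zero. *)
Lemma ri_series (phi : nat -> T -> R) (B : R) :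
  (forall j, ri_set X (phi j)) -> (forall j x, 0 <= phi j x) ->
  (forall n, \sum_(j < n) ri_norm X (phi j) <= B) ->
  exists G, [/\ ri_set X G, forall x, 0 <= G x, ri_norm X G <= B &
    forall j, {ae mu, forall x, phi j x <= G x}].
Proof.
move=> Xphi phi0 sumB.
pose S n x := \sum_(j < n) phi j x.
pose s n := \sum_(j < n) ri_norm X (phi j).
have SS n : S n.+1 = S n \+ phi n.
  by apply/funext => x; rewrite /S big_ord_recr.
have XS n : ri_set X (S n).
  elim: n => [|n IH]; last by rewrite SS; exact: ri_setD.
  by rewrite (_ : S 0%N = cst 0); [exact: ri_set0|apply/funext => x; rewrite /S big_ord0].
have diffS n k : ri_norm X (S (n + k)%N \- S n) <= s (n + k)%N - s n.
  elim: k => [|k IH].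
    rewrite addn0 subrr (_ : S n \- S n = cst 0).
      by have /(ri_norm_eq0 (ri_set0 X)) -> // : {ae mu, forall x, cst 0 x = 0 :> R} by exact: aeW.
    by apply/funext => x /=; rewrite subrr.
  rewrite addnS SS (_ : _ \- _ = (S (n + k)%N \- S n) \+ phi (n + k)%N); last first.
    by apply/funext => x /=; rewrite addrAC.
  have [Xd _] := ri_norm_sub_sym (XS (n + k)%N) (XS n).
  rewrite (le_trans (ri_normD Xd (Xphi _)))// /s big_ord_recr/= addrAC.
  by rewrite lerD2r.
have nds : nondecreasing_seq s.
  apply/nondecreasing_seqP => n; rewrite /s big_ord_recr/= lerDl.
  exact: ri_norm_ge0.
have nS n : ri_norm X (S n) <= B.
  apply: le_trans (sumB n); have := diffS 0%N n.
  rewrite add0n {2}/s big_ord0 subr0 (_ : S n \- S 0%N = S n)//.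
  by apply/funext => x; rewrite /= /S big_ord0 subr0.
have cauchyS (e : R) : 0 < e -> exists n0 : nat, forall m n : nat,
    (n0 <= m)%N -> (n0 <= n)%N -> ri_norm X (S m \- S n) < e.
  move=> e0.
  have supA : has_sup (range s).
    by split; [exists (s 0%N), 0%N|exists B => _ [n _ <-]; exact: sumB].
  have [_ [n0 _ <-] n0e] := sup_adherent e0 supA.
  exists n0; suff main m n : (n0 <= n)%N -> (n <= m)%N -> ri_norm X (S m \- S n) < e.
    move=> m n n0m n0n; have [nm|/ltnW mn] := leqP n m; first exact: main.
    by rewrite (ri_norm_sub_sym (XS m) (XS n)).2; exact: main.
  move=> n0n nm; rewrite -(subnKC nm); apply: (le_lt_trans (diffS _ _)).
  rewrite subnKC//.
  have : s m <= sup (range s) by apply: ub_le_sup; [case: supA|exists m].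
  have : s n0 <= s n by exact: nds.
  by move: n0e; lra.
have [G XG cvG] := ri_complete XS cauchyS.
pose e n := ri_norm X (S n \- G).
have cve : e n @[n --> \oo] --> 0 by exact: cvG.
have small (r : R) : 0 < r -> exists n0, forall n, (n0 <= n)%N -> e n <= r.
  move=> r0; have /cvgrPdist_le /(_ r r0)[n0 _ H] := cve.
  exists n0 => n /H; rewrite sub0r normrN; exact/le_trans/ler_norm.
have SG n : {ae mu, forall x, S n x <= G x}.
  have mpos : measurable_fun setT (fun x => Num.max (S n x - G x) 0).
    apply: measurable_maxr => //; apply: measurable_funB; [exact: ri_meas (XS n)|exact: ri_meas XG].
  have le_pos m : (n <= m)%N -> ri_set X (fun x => Num.max (S n x - G x) 0) /\
      ri_norm X (fun x => Num.max (S n x - G x) 0) <= e m.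
    move=> nm; have [Xd _] := ri_norm_sub_sym (XS m) XG.
    apply: (ri_ideal Xd mpos); apply: aeW => x /=.
    rewrite ger0_norm; last by rewrite le_max lexx orbT.
    rewrite ge_max normr_ge0 andbT (le_trans _ (ler_norm _))// lerD2r.
    rewrite -(subnKC nm); elim: (m - n)%N => [|k IH]; first by rewrite addn0.
    by rewrite addnS SS (le_trans IH)//= lerDl.
  have [Xp _] := le_pos n (leqnn n).
  have : ri_norm X (fun x => Num.max (S n x - G x) 0) = 0.
    apply/eqP; rewrite eq_le ri_norm_ge0// andbT; apply/ler_addgt0Pl => r r0.
    have [n0 Hn0] := small r r0; rewrite addr0.
    have [_ /le_trans] := le_pos (maxn n n0) (leq_maxl _ _); apply.
    by apply: Hn0; exact: leq_maxr.
  move/(ri_norm_eq0 Xp); apply: filterS => x Hx.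
  by rewrite -subr_le0 -Hx le_max lexx.
have Gpos : measurable_fun setT (fun x => Num.max (G x) 0).
  by apply: measurable_maxr => //; exact: ri_meas XG.
have [|XGp nGp] := ri_ideal XG Gpos.
  apply: aeW => x; rewrite ger0_norm; last by rewrite le_max lexx orbT.
  by rewrite ge_max normr_ge0 ler_norm.
exists (fun x => Num.max (G x) 0); split => //.
- by move=> x; rewrite le_max lexx orbT.
- rewrite (le_trans nGp)//; apply/ler_addgt0Pl => r r0.
  have [n0 Hn0] := small r r0.
  have [Xd dE] := ri_norm_sub_sym XG (XS n0).
  rewrite (_ : G = (G \- S n0) \+ S n0); last by apply/funext => x /=; rewrite subrK.
  rewrite (le_trans (ri_normD Xd (XS _)))//; apply: lerD => //.
  by rewrite dE; exact: Hn0.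
- move=> j; have := SG j.+1; apply: filterS => x SGx.
  rewrite le_max; apply/orP; left; apply: le_trans SGx.
  by rewrite SS /= lerDr /S sumr_ge0.
Qed.

Hypothesis mu_small : has_small_cover mu.

(** Otherwise [H] would dominate, up to rearrangement, arbitrarily large multiples
    of the indicator of [E0]. *)
Lemma ri_finite_level (E0 : set T) (H : T -> R) : measurable E0 ->
  (0 < mu E0 < +oo)%E -> ri_set X H -> (forall x, 0 <= H x) ->
  exists2 la : R, 0 < la & (mu [set x | (la < H x)%R] < +oo)%E.
Proof.
move=> mE0 E0fin XH H0; have n0 := ri_norm_indic_gt0 X mE0 E0fin.
have /andP[E0_gt0 E0oo] := E0fin.
have finE : mu E0 \is a fin_num by rewrite ge0_fin_numE.
pose la := ri_norm X H / ri_norm X \1_E0 + 1.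
have la0 : 0 < la.
  by apply: ltr_wpDl => //; apply: divr_ge0; [exact: ri_norm_ge0|exact: ltW].
exists la => //; rewrite ltey; apply/eqP => Hoo.
have mL : measurable [set x | la < H x].
  by apply: measurable_ltr_set => //; exact: ri_meas XH.
have [||F [mF FL muF]] := @exact_subset _ _ _ mu mu_small _ (fine (mu E0)) mL.
- exact: fine_ge0.
- by rewrite Hoo leey.
have Foo : (mu F < +oo)%E by rewrite muF ltry.
have XE := ri_indic X mE0 E0oo; have XF := ri_indic X mF Foo.
have lev (A : set T) (r : R) : 0 <= r ->
    [set x | r < `|\1_A x : R|] = if r < 1 then A else set0.
  move=> r0; apply/seteqP; split=> x /=; rewrite indicE.
    have [Ax|nAx] := pselect (A x); first by rewrite mem_set// normr1 => ->.
    by rewrite memNset// normr0 ltNge r0.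
  by case: ifP => // r1 Ax; rewrite mem_set// normr1.
have [|_ nF] := ri_equidistributed XE (ri_meas XF).
  by move=> r r0; rewrite !lev//; case: ifP => // _; rewrite muF fineK.
have [|_] := ri_ideal XH (ri_meas (ri_setZ la XF)).
  apply: aeW => x; rewrite indicE; have [Fx|nFx] := pselect (F x).
    by rewrite mem_set// mulr1 !ger0_norm// ltW//; exact: FL.
  by rewrite memNset// mulr0 normr0.
rewrite ri_normZ// nF gtr0_norm// -ler_pdivlMr// /la.
by rewrite leNgt ltrDl ltr01.
Qed.

End ri_series.

(** * The quasi-norm of the convexified space *)

Section convexification.
Context {d : measure_display} {T : measurableType d} {R : realType}.
Variables (mu : {measure set T -> \bar R}) (X : ri_space mu) (a : R).
Hypotheses (a_gt0 : 0 < a) (a_le1 : a <= 1).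
Implicit Types f g h : T -> R.

Let a_neq0 : a != 0. Proof. by rewrite gt_eqF. Qed.

Lemma cvx_normE f : cvx_set X a f ->
  cvx_norm X a f = (ri_norm X (fun x => `|f x| `^ a) `^ a^-1)%:E.
Proof. by move=> Xf; rewrite /cvx_norm /ext_norm asboolT. Qed.

Lemma cvx_norm_ge0 f : (0 <= cvx_norm X a f)%E.
Proof.
by rewrite /cvx_norm /ext_norm; case: asboolP => // _; rewrite lee_fin powR_ge0.
Qed.

Lemma cvx_normVy f : cvx_set X a f \/ cvx_norm X a f = +oo%E.
Proof. by rewrite /cvx_norm /ext_norm; case: asboolP => ?; [left|right]. Qed.

Lemma cvx_norm_le f g (c : R) : cvx_set X a f -> measurable_fun setT g -> 0 <= c ->
  {ae mu, forall x, `|g x| <= c * `|f x|} ->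
  cvx_set X a g /\ (cvx_norm X a g <= c%:E * cvx_norm X a f)%E.
Proof.
move=> [mf Xf] mg c0 gf.
have [|Xg ng] := ri_ideal (ri_setZ (c `^ a) Xf) (measurable_powR_norm a mg).
  apply: filterS gf => x gfx.
  rewrite ger0_norm ?powR_ge0// [leRHS]ger0_norm ?mulr_ge0 ?powR_ge0//.
  rewrite -powRM//; apply: ge0_ler_powR; rewrite ?nnegrE ?mulr_ge0 ?(ltW a_gt0)//.
have Sg : cvx_set X a g by [].
split=> //; rewrite !cvx_normE// -EFinM lee_fin -(powRK a_neq0 c0).
rewrite ri_normZ// ger0_norm ?powR_ge0// in ng.
rewrite -powRM ?powR_ge0 ?ri_norm_ge0//.
by apply: ge0_ler_powR; rewrite ?nnegrE ?mulr_ge0 ?invr_ge0 ?powR_ge0 ?ri_norm_ge0 ?(ltW a_gt0).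
Qed.

Lemma cvx_normD f g h : measurable_fun setT h ->
  {ae mu, forall x, `|h x| <= `|f x| + `|g x|} ->
  (cvx_norm X a h <= (2 `^ a^-1)%:E * (cvx_norm X a f + cvx_norm X a g))%E.
Proof.
move=> mh hfg; have c0 : 0 < 2 `^ a^-1 :> R by rewrite powR_gt0.
have [Xf|->] := cvx_normVy f; last first.
  by rewrite addye ?gt_eqF ?gt0_muley ?leey// (lt_le_trans _ (cvx_norm_ge0 g)).
have [Xg|->] := cvx_normVy g; last first.
  by rewrite addey ?gt_eqF ?gt0_muley ?leey// (lt_le_trans _ (cvx_norm_ge0 f)).
have [mf Xfa] := Xf; have [mg Xga] := Xg.
have [|Xh nh] := ri_ideal (ri_setD Xfa Xga) (measurable_powR_norm a mh).
  apply: filterS hfg => x hx /=.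
  rewrite ger0_norm ?powR_ge0// [leRHS]ger0_norm ?addr_ge0 ?powR_ge0//.
  rewrite (le_trans _ (powR_subadditive a_gt0 a_le1 _ _))//.
  by apply: ge0_ler_powR; rewrite ?nnegrE ?addr_ge0 ?(ltW a_gt0).
have Sh : cvx_set X a h by [].
rewrite !cvx_normE// -EFinD -EFinM lee_fin.
apply: le_trans (powR_addr_max _ _ _); rewrite ?invr_gt0 ?ri_norm_ge0//.
apply: ge0_ler_powR; rewrite ?nnegrE ?addr_ge0 ?invr_ge0 ?ri_norm_ge0 ?(ltW a_gt0)//.
exact: le_trans nh (ri_normD _ _).
Qed.

Lemma cvx_set_powR (G : T -> R) : ri_set X G -> (forall x, 0 <= G x) ->
  cvx_set X a (fun x => G x `^ a^-1) /\
  cvx_norm X a (fun x => G x `^ a^-1) = (ri_norm X G `^ a^-1)%:E.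
Proof.
move=> XG G0.
have GE : (fun x => `|G x `^ a^-1| `^ a) = G.
  by apply/funext => x; rewrite ger0_norm ?powR_ge0// powRVK.
have S : cvx_set X a (fun x => G x `^ a^-1).
  by split; [exact: (measurableT_comp (measurable_powR _) (ri_meas XG))|rewrite /= GE].
by split=> //; rewrite cvx_normE// GE.
Qed.

Lemma L_plus_LinftyD f g : L_plus_Linfty mu a f -> L_plus_Linfty mu a g ->
  L_plus_Linfty mu a (f \+ g).
Proof.
move=> [f0 [f1 [mf0 mf1 nf0 nf1 ->]]] [g0 [g1 [mg0 mg1 ng0 ng1 ->]]].
exists (f0 \+ g0), (f1 \+ g1); split; [exact: measurable_funD..| | |].
- have f0a := finite_norm_powR a_gt0 nf0; have g0a := finite_norm_powR a_gt0 ng0.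
  apply: powR_finite_norm.
  have meas (k : T -> R) : measurable_fun setT k -> measurable_fun setT (fun x => (`|k x| `^ a)%:E).
    by move=> mk; exact/measurable_EFinP/measurable_powR_norm.
  apply: (@le_lt_trans _ _ (\int[mu]_x ((`|f0 x| `^ a)%:E + (`|g0 x| `^ a)%:E))%E).
    apply: ge0_le_integral => //.
    + exact: meas (measurable_funD mf0 mg0).
    + by apply: emeasurable_funD; exact: meas.
    + by move=> x _; rewrite -EFinD lee_fin; exact: (powR_normD_le a_gt0 a_le1).
  rewrite ge0_integralD; [|exact: measurableT|by []|exact: meas|by []|exact: meas].
  exact: (lte_add_pinfty f0a g0a).
- have [M M0 Mf] := finite_norm_esssup nf1; have [N N0 Ng] := finite_norm_esssup ng1.
  apply: (@esssup_finite_norm _ _ _ _ _ (M + N)).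
  apply: filterS2 Mf Ng => x fM gN /=.
  by rewrite (le_trans (ler_normD _ _))// lerD.
- by apply/funext => x /=; rewrite addrACA.
Qed.

(** Cut [h] at a level above which it lives on a set of finite measure, where
    [|h| `^ a] is integrable. *)
Lemma cvx_set_L_plus_Linfty (E0 : set T) h : has_small_cover mu -> measurable E0 ->
  (0 < mu E0 < +oo)%E -> cvx_set X a h -> L_plus_Linfty mu a h.
Proof.
move=> small mE0 E0fin [mh Xh].
have ha0 x : 0 <= `|h x| `^ a by exact: powR_ge0.
have [la la0 Loo] := ri_finite_level small mE0 E0fin Xh ha0.
set L := [set x | _] in Loo.
have mL : measurable L.
  by apply: measurable_ltr_set => //; exact: measurable_powR_norm.
exists (fun x => h x * \1_L x), (fun x => h x * \1_(~` L) x); split.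
- by apply: measurable_funM => //; exact: measurable_indic.
- by apply: measurable_funM => //; apply: measurable_indic; exact: measurableC.
- apply: powR_finite_norm.
  have := ri_integrable_finite small mL Loo Xh ha0; apply: le_lt_trans.
  rewrite [leRHS]integral_mkcond le_eqVlt; apply/orP; left; apply/eqP.
  apply: eq_integral => x _; rewrite patchE indicE.
  by case: ifP => _; rewrite ?mulr1// mulr0 normr0 powR0.
- apply: (@esssup_finite_norm _ _ _ _ _ (la `^ a^-1)).
  apply: aeW => x /=; rewrite indicE.
  have [Lx|nLx] := pselect (L x); first by rewrite memNset// mulr0 normr0 powR_ge0.
  rewrite mem_set// mulr1 -(powRK a_neq0 (normr_ge0 (h x))).
  apply: ge0_ler_powR; rewrite ?nnegrE ?invr_ge0 ?powR_ge0 ?(ltW a_gt0) ?(ltW la0)//.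
  by rewrite leNgt; apply/negP.
- apply/funext => x /=; rewrite !indicE in_setC.
  by case: (x \in L); rewrite /= ?mulr1 ?mulr0 ?addr0 ?add0r.
Qed.

End convexification.

(** * The K-functional is bounded by the smoothness sum *)

Section upper_estimate.
Context {d : measure_display} {R : realType} {T : borelMetricType d R}.
Variable mu : {measure set T -> \bar R}.
Hypothesis mu_doubling : doubling mu.
Hypothesis mu_point : forall x : T, mu [set x] = 0%E.
Variables (X : ri_space mu) (a : R).
Hypotheses (a_gt0 : 0 < a) (a_le1 : a <= 1).
Variable x0 : T.
Implicit Types (f g : T -> R) (t : R).

Let a_neq0 : a != 0. Proof. by rewrite gt_eqF. Qed.

Lemma continuous_locally_lipschitz f (L : T -> R) t : 0 < t -> (forall x, 0 <= L x) ->
  (forall x y, mdist x y < t -> `|f x - f y| <= L x * mdist x y) -> continuous f.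
Proof.
move=> t0 L0 lip x; apply/cvgrPdist_le => e e0.
have L1 : 0 < L x + 1 by rewrite ltr_wpDl.
near=> y.
have /ballE xyt : ball x t y by near: y; exact: nbhsx_ballx.
have /ballE xye : ball x (e / (L x + 1)) y.
  by near: y; apply: nbhsx_ballx; rewrite divr_gt0.
apply: (le_trans (lip _ _ xyt)).
rewrite ltr_pdivlMr// in xye; apply: le_trans (ltW xye).
by rewrite mulrC ler_wpM2l ?mdist_ge0// lerDl.
Unshelve. all: by end_near. Qed.

Lemma Kfun_le (N0 N1 : (T -> R) -> \bar R) f f0 f1 t :
  {ae mu, forall x, f x = f0 x + f1 x} ->
  (Kfun mu N0 N1 f t <= N0 f0 + t%:E * N1 f1)%E.
Proof. by move=> ff; apply: ereal_inf_lbound; exists (f0, f1). Qed.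

(** One function controls the moduli of smoothness at all scales [2 ^+ j * t]; the
    weights are those of the sum in the theorem. *)
Lemma dyadic_envelope f t (B : R) :
  (forall j, cvx_set X a (nabla mu a (2 ^+ j * t) f)) ->
  (forall n, \sum_(j < n) 2 `^ (- (j%:R * a)) *
      ri_norm X (fun x => `|nabla mu a (2 ^+ j * t) f x| `^ a) <= B) ->
  exists Ga : T -> R, [/\ cvx_set X a Ga, forall x, 0 <= Ga x,
    (cvx_norm X a Ga <= (B `^ a^-1)%:E)%E &
    {ae mu, forall x, forall j, nabla mu a (2 ^+ j * t) f x <= 2 ^+ j * Ga x}].
Proof.
move=> Xn sumB.
pose phi j x := 2 `^ (- (j%:R * a)) * `|nabla mu a (2 ^+ j * t) f x| `^ a.
have Xphi j : ri_set X (phi j) by apply: ri_setZ; exact: (Xn j).2.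
have phi0 j x : 0 <= phi j x by rewrite mulr_ge0 ?powR_ge0.
have [n|G [XG G0 nG phiG]] := @ri_series _ _ _ mu X phi B Xphi phi0.
  apply: le_trans (sumB n); rewrite le_eqVlt; apply/orP; left; apply/eqP.
  apply: eq_bigr => j _; rewrite ri_normZ; last exact: (Xn j).2.
  by rewrite ger0_norm ?powR_ge0.
have [S nS] := cvx_set_powR a_gt0 XG G0.
exists (fun x => G x `^ a^-1); split=> //.
- by move=> x; exact: powR_ge0.
- rewrite nS lee_fin; apply: ge0_ler_powR => //.
  + by rewrite invr_ge0 ltW.
  + by rewrite nnegrE ri_norm_ge0.
  + by rewrite nnegrE (le_trans (ri_norm_ge0 XG)).
have := ae_foralln phiG; apply: filterS => x H j.
have n0 : 0 <= nabla mu a (2 ^+ j * t) f x by exact: powR_ge0.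
have := H j; rewrite /phi (ger0_norm n0) powRN ler_pdivrMl ?powR_gt0// => nG'.
rewrite -(powRK a_neq0 n0).
have -> : 2 ^+ j * G x `^ a^-1 = (2 `^ (j%:R * a) * G x) `^ a^-1.
  by rewrite powRM ?powR_ge0// -powRrM mulfK// powR_mulrn.
apply: ge0_ler_powR => //.
- by rewrite invr_ge0 ltW.
- by rewrite nnegrE powR_ge0.
- by rewrite nnegrE mulr_ge0 ?powR_ge0.
Qed.

Lemma dyadic_scale (t r : R) : 0 < t -> t <= r ->
  exists j : nat, r < 2 ^+ j * t <= 2 * r.
Proof.
move=> t0 tr.
have ex : exists j : nat, r < 2 ^+ j * t.
  exists (Num.truncn (r / t)).+1; rewrite -ltr_pdivrMr//.
  by rewrite (lt_le_trans (truncnS_gt _))// -natrX ler_nat ltnW// ltn_expl.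
have [[|j] rj jmin] := ex_minnP ex.
  by move: rj; rewrite expr0 mul1r ltNge tr.
exists j.+1; rewrite rj exprS -mulrA ler_pM2l//= leNgt; apply/negP => /jmin.
by rewrite ltnn.
Qed.

Lemma K_le_smoothness_sum : exists2 c : R, 0 < c & forall f t,
  L_plus_Linfty mu a f -> 0 < t ->
  (Kfun mu (cvx_norm X a) (hom_sobolev_norm X a) f t <= c%:E *
   ((\sum_(0 <= j <oo) ((2 `^ (- (j%:R * a)))%:E *
       smoothness X a f (2 ^+ j * t)%R `^ a)) `^ a^-1))%E.
Proof.
have [ka ka0 osc] := nabla_oscillation mu_doubling a_gt0 a_le1.
have [C dbl] := exists_doubling_bound mu_doubling.
have small := doubling_small_cover mu_doubling dbl mu_point.
exists (96 * ka); first by rewrite mulr_gt0.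
move=> f t Lf t0; have mf := L_plus_Linfty_measurable Lf.
pose E j := smoothness X a f (2 ^+ j * t).
pose term j := ((2 `^ (- (j%:R * a)))%:E * E j `^ a)%E.
rewrite -/(term _).
set SS := (\sum_(0 <= j <oo) _)%E.
have term0 j : (0 <= term j)%E by rewrite mule_ge0 ?lee_fin ?powR_ge0 ?poweR_ge0.
have SS0 : (0 <= SS)%E by apply: nneseries_ge0 => j _ _; exact: term0.
have c0 : (0 < (96 * ka)%:E)%E by rewrite lte_fin mulr_gt0.
have [->|SSoo] := eqVneq SS +oo%E.
  by rewrite poweRyr ?invr_neq0// gt0_muley// leey.
have finSS : SS \is a fin_num by rewrite ge0_fin_numE// ltey.
have SSn n : (\sum_(0 <= j < n) term j <= SS)%E.
  by apply: nneseries_lim_ge => j _ _; exact: term0.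
have termoo j : (term j < +oo)%E.
  rewrite (@le_lt_trans _ _ SS)// ?ltey// (le_trans _ (SSn j.+1))//.
  by rewrite big_nat_recr//= leeDr// sume_ge0.
have Xn j : cvx_set X a (nabla mu a (2 ^+ j * t) f).
  have [//|Ey] := cvx_normVy X a (nabla mu a (2 ^+ j * t) f).
  have := termoo j; rewrite /term /E /smoothness Ey poweRyr//.
  by rewrite gt0_muley ?ltxx// lte_fin powR_gt0.
have termE j : term j = (2 `^ (- (j%:R * a)) *
    ri_norm X (fun x => `|nabla mu a (2 ^+ j * t) f x| `^ a))%:E.
  rewrite /term /E /smoothness cvx_normE// poweR_EFin powRVK ?EFinM//.
  by apply: ri_norm_ge0; exact: (Xn j).2.
have [n|Ga [XGa Ga0 nGa nabGa]] := @dyadic_envelope f t (fine SS) Xn.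
  rewrite -lee_fin fineK// (le_trans _ (SSn n))// big_mkord -sumEFin.
  by apply: lee_sum => j _; rewrite termE.
(* The regularization looks at pairs of points at distance less than [12 t],
   and [2 * (16 * t)] is the dyadic scale [2 ^+ 5 * t]. *)
pose D x := ka * nabla mu a (2 * (16 * t)) f x.
have D0 x : 0 <= D x by rewrite mulr_ge0 ?powR_ge0 ?ltW.
have mD : measurable_fun setT D by apply: measurable_funM => //; exact: measurable_nabla.
have Dosc x y : mdist x y < 12 * t -> `|f x - f y| <= D x + D y.
  move=> xy; rewrite -mulrDr; apply: osc => //; first by rewrite mulr_gt0.
  by rewrite (lt_le_trans xy)// ler_pM2r//; lra.
have [f1 [ff1 lip]] := lipschitz_regularization t0 Dosc.
have mf1 : measurable_fun setT f1.
  apply/measurable_continuous/(@continuous_locally_lipschitz _ (fun x => 2 * D x / t) _ t0).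
    by move=> x; apply: divr_ge0; [exact: mulr_ge0|exact: ltW].
  by move=> x y /lip; rewrite mulrA mulrAC.
pose Z := ~` [set x | forall j, nabla mu a (2 ^+ j * t) f x <= 2 ^+ j * Ga x].
have nab x j : ~ Z x -> nabla mu a (2 ^+ j * t) f x <= 2 ^+ j * Ga x.
  by move=> /contrapT; exact.
have DGa x : ~ Z x -> D x <= 32 * ka * Ga x.
  move=> /(nab _ 5) H; rewrite /D (_ : 2 * (16 * t) = 2 ^+ 5 * t); last by ring.
  have -> : 32 * ka * Ga x = ka * (32 * Ga x) by ring.
  rewrite ler_pM2l// (le_trans H)//.
  by rewrite (_ : 2 ^+ 5 = 32 :> R)//; ring.
have far x y : ~ Z x -> ~ Z y -> t <= mdist x y ->
    `|f1 x - f1 y| <= 36 * ka / t * mdist x y * (Ga x + Ga y).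
  move=> Zx Zy txy; have [j /andP[xyj jxy]] := dyadic_scale t0 txy.
  have jt0 : 0 < 2 ^+ j * t by rewrite mulr_gt0// exprn_gt0.
  have fxy : `|f x - f y| <= ka * (4 * (mdist x y / t) * (Ga x + Ga y)).
    apply: (le_trans (osc f _ x y Lf jt0 xyj)); rewrite ler_pM2l//.
    rewrite [2 * (2 ^+ j * t)]mulrA -exprS; apply: (le_trans (lerD (nab x j.+1 Zx) (nab y j.+1 Zy))).
    rewrite -mulrDr ler_wpM2r ?addr_ge0// exprS.
    have -> : 4 * (mdist x y / t) = 2 * (2 * mdist x y / t) by ring.
    by rewrite ler_pM2l// ler_pdivlMr.
  have r1 : 1 <= mdist x y / t by rewrite ler_pdivlMr// mul1r.
  have close z : ~ Z z -> `|f z - f1 z| <= 32 * ka * (mdist x y / t) * Ga z.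
    move=> Zz; rewrite (le_trans (ff1 z))// (le_trans (DGa z Zz))//.
    rewrite ler_wpM2r// ler_peMr// mulr_ge0// ltW//.
  have -> : 36 * ka / t * mdist x y * (Ga x + Ga y) =
      ka * (4 * (mdist x y / t) * (Ga x + Ga y)) +
      (32 * ka * (mdist x y / t) * Ga x + 32 * ka * (mdist x y / t) * Ga y) by ring.
  (* Regularization error at both points plus oscillation of [f] itself. *)
  have -> : f1 x - f1 y = (f x - f y) + ((f1 x - f x) + (f y - f1 y)) by ring.
  rewrite (le_trans (ler_normD _ _))// lerD// (le_trans (ler_normD _ _))// lerD ?close//.
  by rewrite distrC close.
pose g x := 64 * ka / t * Ga x.
have c640 : 0 < 64 * ka / t by rewrite divr_gt0 ?mulr_gt0.
have gD : hajlasz_grad mu f1 g.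
  split.
  - by apply: measurable_funM => //; exact: XGa.1.
  - by move=> x; rewrite mulr_ge0// ltW.
  exists Z => // x y Zx Zy; rewrite /g -mulrDr mulrCA mulrA.
  have [xyt|txy] := ltP (mdist x y) t; last first.
    apply: (le_trans (far x y Zx Zy txy)); rewrite ler_wpM2r ?addr_ge0//.
    rewrite ler_wpM2r ?mdist_ge0// ler_wpM2r ?invr_ge0 ?(ltW t0)// ler_pM2r//.
    by lra.
  apply: (le_trans (lip x y xyt)).
  have -> : 64 * ka / t * mdist x y * (Ga x + Ga y) =
      2 * (32 * ka * (Ga x + Ga y)) * (mdist x y / t) by ring.
  rewrite ler_wpM2r ?divr_ge0 ?mdist_ge0 ?(ltW t0)// ler_pM2l//.
  rewrite (le_trans (DGa x Zx))// ler_wpM2l ?mulr_ge0 ?(ltW ka0)//.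
  by rewrite lerDl.
have [Xf0 nf0] : cvx_set X a (f \- f1) /\
    (cvx_norm X a (f \- f1)%R <= (32 * ka)%:E * cvx_norm X a Ga)%E.
  apply: cvx_norm_le => //; [exact: measurable_funB|by rewrite mulr_ge0// ltW|].
  apply: filterS nabGa => x nabx; rewrite (ger0_norm (Ga0 x)).
  by rewrite (le_trans (ff1 x))// DGa//; apply/contrapT/contrapT.
have [Xg ng] : cvx_set X a g /\
    (cvx_norm X a g <= (64 * ka / t)%:E * cvx_norm X a Ga)%E.
  apply: cvx_norm_le => //; [|exact: ltW|].
    by apply: measurable_funM => //; exact: XGa.1.
  by apply: aeW => x; rewrite /g normrM (gtr0_norm c640).
have Lf1 : L_plus_Linfty mu a f1.
  have Xf0' : cvx_set X a (f1 \- f).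
    have [|//] := cvx_norm_le a_gt0 Xf0 (measurable_funB mf1 mf) ler01.
    by apply: aeW => x; rewrite mul1r distrC.
  have -> : f1 = f \+ (f1 \- f) by apply/funext => x /=; rewrite addrC subrK.
  apply: L_plus_LinftyD => //.
  apply: (cvx_set_L_plus_Linfty (E0 := ball x0 1) a_gt0 small _ _ Xf0').
    exact: measurable_metric_ball.
  by rewrite ball_gt0// ball_lty.
have homf1 : (hom_sobolev_norm X a f1 <= cvx_norm X a g)%E.
  by rewrite /hom_sobolev_norm asboolT//; apply: ereal_inf_lbound; exists g.
apply: (le_trans (@Kfun_le _ _ f (f \- f1) f1 t _)).
  by apply: aeW => x /=; rewrite subrK.
apply: (@le_trans _ _ ((96 * ka)%:E * cvx_norm X a Ga)%E); last first.
  apply: lee_wpmul2l; first exact: ltW.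
  by rewrite (le_trans nGa)// -{2}(fineK finSS) poweR_EFin.
have -> : ((96 * ka)%:E * cvx_norm X a Ga = (32 * ka)%:E * cvx_norm X a Ga +
    t%:E * ((64 * ka / t)%:E * cvx_norm X a Ga))%E.
  rewrite (cvx_normE XGa) -!EFinM -EFinD; congr (_%:E).
  by field; rewrite gt_eqF.
apply: leeD => //; apply: lee_wpmul2l; first by rewrite lee_fin ltW.
exact: le_trans homf1 ng.
Qed.

End upper_estimate.

(** * The smoothness is bounded by the K-functional *)

Section lower_estimate.
Context {d : measure_display} {R : realType} {T : borelMetricType d R}.
Variable mu : {measure set T -> \bar R}.
Hypothesis mu_doubling : doubling mu.
Hypothesis mu_point : forall x : T, mu [set x] = 0%E.
Variables (X : ri_space mu) (a : R).
Hypotheses (a_gt0 : 0 < a) (a_le1 : a <= 1).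
Implicit Types (f g h : T -> R) (t : R).

Let a_neq0 : a != 0. Proof. by rewrite gt_eqF. Qed.

Lemma nabla_powR_le f h (Z : set T) x t : 0 < t -> measurable_fun setT f ->
  ri_set X h -> (forall y, 0 <= h y) -> mu.-negligible Z ->
  (forall y, ~ Z y -> mdist x y < t -> `|f x - f y| `^ a <= h x + h y) ->
  nabla mu a t f x `^ a <= h x + average mu (ball x t) h.
Proof.
move=> t0 mf Xh h0 negZ fh; rewrite nabla_powR//.
have [C dbl] := exists_doubling_bound mu_doubling.
have small := doubling_small_cover mu_doubling dbl mu_point.
have mB := measurable_metric_ball x t.
have Boo := ball_lty mu_doubling x t0.
have m0 := fine_ball_gt0 mu_doubling x t0.
have hoo := ri_integrable_finite small mB Boo Xh h0.
have mh := ri_meas Xh.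
have finh : (\int[mu]_(y in ball x t) (h y)%:E)%E \is a fin_num.
  by rewrite ge0_fin_numE ?integral_EFin_ge0.
have le1 : (\int[mu]_(y in ball x t) (`|f x - f y| `^ a)%:E <=
    (h x * fine (mu (ball x t)))%:E + \int[mu]_(y in ball x t) (h y)%:E)%E.
  rewrite EFinM fineK ?(ball_fin mu_doubling)// -integral_cst//.
  rewrite -ge0_integralD//; last 3 first.
  - by move=> y _; rewrite lee_fin.
  - by move=> y _; rewrite lee_fin.
  - exact/measurable_EFinP/measurable_funTS.
  apply: ae_ge0_le_integral => //.
  - apply/measurable_EFinP/measurable_funTS/measurable_powR_norm.
    exact: measurable_funB.
  - by move=> y _; rewrite adde_ge0// lee_fin.
  - by apply: emeasurable_funD => //; exact/measurable_EFinP/measurable_funTS.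
  - have [N [mN N0 ZN]] := negZ; exists N; split=> // y /= H.
    apply: contrapT => nNy; apply: H => /ballE xy; rewrite -EFinD lee_fin.
    by apply: fh => // /ZN.
rewrite /average ler_pdivrMr// mulrDl divfK ?gt_eqF//.
rewrite -lee_fin EFinD /Rintegral [X in (_ <= _ + X)%E]fineK// fineK//.
rewrite ge0_fin_numE; last by apply: integral_EFin_ge0 => y; exact: powR_ge0.
by rewrite (le_lt_trans le1)// -(fineK finh) -EFinD ltry.
Qed.

(** The bound comes from the majorant [h + average h] of [nabla f `^ a], where [h]
    collects [f0] and the gradient [g]. *)
Lemma smoothness_le_splitting : exists2 c : R, 0 < c & forall f f0 f1 g t, 0 < t ->
  L_plus_Linfty mu a f -> cvx_set X a (nabla mu a t f) \/ majorization_closed X ->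
  {ae mu, forall x, f x = f0 x + f1 x} -> cvx_set X a f0 ->
  hajlasz_grad mu f1 g -> cvx_set X a g ->
  (smoothness X a f t <= c%:E * (cvx_norm X a f0 + t%:E * cvx_norm X a g))%E.
Proof.
have [La La0 bounds] := ball_average_bounds mu_doubling mu_point X.
exists (La `^ a^-1 * 2 `^ a^-1); first by rewrite mulr_gt0 ?powR_gt0.
move=> f f0 f1 g t t0 Lf Xnabla ff Xf0 [mg g0 [Z negZ gZ]] Xg.
have mf := L_plus_Linfty_measurable Lf.
have [mf0 Xf0a] := Xf0; have Xga := Xg.2.
have ta0 : 0 <= t `^ a by exact: powR_ge0.
pose h := (fun x => `|f0 x| `^ a) \+ (fun x => t `^ a * `|g x| `^ a).
have Xh : ri_set X h by apply: ri_setD => //; exact: ri_setZ.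
have h0 x : 0 <= h x by rewrite addr_ge0 ?mulr_ge0 ?powR_ge0.
have nh : ri_norm X h <= ri_norm X (fun x => `|f0 x| `^ a) +
    t `^ a * ri_norm X (fun x => `|g x| `^ a).
  rewrite (le_trans (ri_normD Xf0a (ri_setZ _ Xga)))// ri_normZ//.
  by rewrite ger0_norm.
pose v x := `|nabla mu a t f x| `^ a.
have vE x : v x = nabla mu a t f x `^ a by rewrite /v ger0_norm ?powR_ge0.
have mn : measurable_fun setT (nabla mu a t f) by exact: measurable_nabla.
have mv : measurable_fun setT v by exact: measurable_powR_norm.
have v0 x : 0 <= v x by exact: powR_ge0.
pose Z' := Z `|` ~` [set x | f x = f0 x + f1 x].
have negZ' : mu.-negligible Z' by exact: negligibleU.
have vh : {ae mu, forall x, v x <= h x + average mu (ball x t) h}.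
  suff : ~` Z' `<=` [set x | v x <= h x + average mu (ball x t) h].
    by move=> H; apply: negligibleS negZ' => x /= nH; apply: contrapT => /H.
  move=> x /not_orP[Zx /contrapT fx] /=; rewrite vE.
  apply: (@nabla_powR_le f h Z') => // y /not_orP[Zy /contrapT fy] xy.
  have -> : f x - f y = (f0 x - f0 y) + (f1 x - f1 y) by rewrite fx fy; ring.
  rewrite (le_trans (powR_normD_le a_gt0 a_le1 _ _))//.
  have e1 : `|f0 x - f0 y| `^ a <= `|f0 x| `^ a + `|f0 y| `^ a.
    by rewrite (le_trans (powR_normD_le a_gt0 a_le1 _ _))// normrN.
  have e2 : `|f1 x - f1 y| `^ a <= t `^ a * `|g x| `^ a + t `^ a * `|g y| `^ a.
    apply: (@le_trans _ _ ((t * (g x + g y)) `^ a)).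
      apply: ge0_ler_powR; rewrite ?nnegrE ?(ltW a_gt0) ?mulr_ge0 ?addr_ge0 ?(ltW t0)//.
      by rewrite (le_trans (gZ x y Zx Zy))// ler_wpM2r ?addr_ge0// ltW.
    rewrite powRM ?addr_ge0// ?(ltW t0)// -mulrDr ler_wpM2l//.
    by rewrite !ger0_norm//; exact: powR_subadditive.
  by rewrite (le_trans (lerD e1 e2))// /h /= addrACA.
have [normv excessv] := bounds t h v t0 Xh h0 mv v0 vh.
have Xv : ri_set X v.
  case: Xnabla => [[_ //]|maj].
  have XLh := ri_setZ La Xh.
  apply: (maj (fun x => La * h x) v XLh mv).
  apply: submajorization_excess => //; first exact: doubling_sigma_finite.
  - exact: ri_meas XLh.
  - by move=> x; rewrite mulr_ge0// ltW.
have Sn : cvx_set X a (nabla mu a t f) by [].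
rewrite /smoothness !cvx_normE// -EFinM lee_fin.
set A := ri_norm X (fun x => `|f0 x| `^ a) in nh *.
set B := ri_norm X (fun x => `|g x| `^ a) in nh *.
have A0 : 0 <= A by exact: ri_norm_ge0.
have B0 : 0 <= B by exact: ri_norm_ge0.
have tB0 : 0 <= t `^ a * B by rewrite mulr_ge0.
apply: (@le_trans _ _ ((La * (A + t `^ a * B)) `^ a^-1)).
  apply: ge0_ler_powR; rewrite ?nnegrE ?invr_ge0 ?(ltW a_gt0) ?ri_norm_ge0//.
    by rewrite mulr_ge0 ?addr_ge0// ltW.
  by rewrite (le_trans (normv Xv))// ler_pM2l.
rewrite powRM ?addr_ge0// ?(ltW La0)// -mulrA ler_wpM2l ?powR_ge0//.
rewrite (le_trans (powR_addr_max _ A0 tB0)) ?invr_gt0// ler_wpM2l ?powR_ge0//.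
by rewrite powRM// powRK// ltW.
Qed.

Lemma hom_sobolev_norm_ge0 f : (0 <= hom_sobolev_norm X a f)%E.
Proof.
rewrite /hom_sobolev_norm; case: ifP => // _.
by apply/ereal_infP => _ [g _ <-]; exact: cvx_norm_ge0.
Qed.

Lemma smoothness_le_K : exists2 c : R, 0 < c & forall f t,
  L_plus_Linfty mu a f -> 0 < t ->
  cvx_set X a (nabla mu a t f) \/ majorization_closed X ->
  (smoothness X a f t <=
   c%:E * Kfun mu (cvx_norm X a) (hom_sobolev_norm X a) f t)%E.
Proof.
have [c c0 split] := smoothness_le_splitting; exists c => // f t Lf t0 Xnabla.
rewrite -lee_pdivrMl//; apply/ereal_infP => _ [[f0 f1] /= ff <-].
have tH0 : (0 <= t%:E * hom_sobolev_norm X a f1)%E.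
  by rewrite mule_ge0 ?hom_sobolev_norm_ge0// lee_fin ltW.
have [Xf0|->] := cvx_normVy X a f0; last first.
  by rewrite addye ?leey// gt_eqF// (lt_le_trans _ tH0).
rewrite cvx_normE// -leeBlDl// -lee_pdivrMl// /hom_sobolev_norm.
case: ifP => [_|_]; last by rewrite leey.
apply/ereal_infP => _ [g fg <-].
have [Xg|->] := cvx_normVy X a g; last by rewrite leey.
rewrite lee_pdivrMl// leeBlDl// lee_pdivrMl// -cvx_normE//.
exact: split ff Xf0 fg Xg.
Qed.

End lower_estimate.

(** * The inhomogeneous K-functional *)

Section inhomogeneous.
Context {d : measure_display} {R : realType} {T : borelMetricType d R}.
Variables (mu : {measure set T -> \bar R}) (X : ri_space mu) (a : R).
Hypotheses (a_gt0 : 0 < a) (a_le1 : a <= 1).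
Implicit Types (f g : T -> R) (t : R).

Local Notation N := (cvx_norm X a).
Local Notation H := (hom_sobolev_norm X a).
Local Notation Khom := (Kfun mu N H).
Local Notation Kinh := (Kfun mu N (sobolev_norm X a)).
Local Notation ka := (2 `^ a^-1 : R).

Let ka0 : 0 < ka. Proof. by rewrite powR_gt0. Qed.

Lemma cvx_norm0 : N (cst 0) = 0%E.
Proof.
have E : (fun x : T => `|cst 0 x : R| `^ a) = cst 0.
  by apply/funext => x; rewrite normr0 powR0// gt_eqF.
have S : cvx_set X a (cst 0) by split=> //=; rewrite E; exact: ri_set0.
rewrite cvx_normE// E (_ : ri_norm X (cst 0) = 0) ?powR0 ?invr_neq0 ?gt_eqF//.
by apply/(ri_norm_eq0 (ri_set0 X)); exact: aeW.
Qed.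

Lemma hom_sobolev_norm0 : H (cst 0) = 0%E.
Proof.
apply/eqP; rewrite eq_le hom_sobolev_norm_ge0 andbT -cvx_norm0.
rewrite /hom_sobolev_norm asboolT; last first.
  exists (cst 0), (cst 0); split=> //.
  - apply: powR_finite_norm; under eq_integral do rewrite normr0 powR0 ?gt_eqF//.
    by rewrite integral0.
  - by apply: (@esssup_finite_norm _ _ _ _ _ 0); apply: aeW => x; rewrite normr0.
  - by apply/funext => x /=; rewrite addr0.
apply: ereal_inf_lbound; exists (cst 0) => //; split => //.
exists set0; first exact: negligible_set0.
by move=> x y _ _; rewrite !addr0 subrr normr0 mulr0.
Qed.

Lemma Kfun_ge0 (N0 N1 : (T -> R) -> \bar R) f t : 0 <= t ->
  (forall g, 0 <= N0 g)%E -> (forall g, 0 <= N1 g)%E -> (0 <= Kfun mu N0 N1 f t)%E.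
Proof.
move=> t0 N00 N10; apply/ereal_infP => _ [p _ <-].
by rewrite adde_ge0// mule_ge0// lee_fin.
Qed.

Lemma hom_sobolev_normVy f : H f = +oo%E \/
  measurable_fun setT f /\ exists2 r : R, 0 <= r & H f = r%:E.
Proof.
have [->|Hoo] := eqVneq (H f) +oo%E; [by left|right].
have Hfin : H f \is a fin_num by rewrite ge0_fin_numE ?ltey// hom_sobolev_norm_ge0.
split; last first.
  by exists (fine (H f)); rewrite ?fineK// fine_ge0// hom_sobolev_norm_ge0.
move: Hoo; rewrite /hom_sobolev_norm; case: asboolP => [Lf _|]; last by rewrite eqxx.
exact: L_plus_Linfty_measurable Lf.
Qed.

Lemma cvx_norm_real f : N f = +oo%E \/ exists2 r : R, 0 <= r & N f = r%:E.
Proof.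
have [Xf|->] := cvx_normVy X a f; [right|by left].
by rewrite cvx_normE//; eexists; last by []; rewrite powR_ge0.
Qed.

Lemma Kinh_le_splitting f f0 f1 t : L_plus_Linfty mu a f -> 0 < t -> t <= 1 ->
  {ae mu, forall x, f x = f0 x + f1 x} ->
  (Kinh f t <= (1 + ka)%:E * (N f0 + t%:E * H f1 + t%:E * N f))%E.
Proof.
move=> Lf t0 t1 ff; apply: (le_trans (Kfun_le _ _ t ff)).
have c0 : 0 < 1 + ka by rewrite addr_gt0.
have ry (y : \bar R) : (y <= (1 + ka)%:E * +oo)%E by rewrite gt0_muley ?lte_fin ?leey.
have tH0 : (0 <= t%:E * H f1)%E by rewrite mule_ge0 ?hom_sobolev_norm_ge0// lee_fin ltW.
have tN0 : (0 <= t%:E * N f)%E by rewrite mule_ge0 ?cvx_norm_ge0// lee_fin ltW.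
have nNy (y : \bar R) : (0 <= y)%E -> y != -oo%E by case: y.
have [N0y|[n0 n00 N0E]] := cvx_norm_real f0.
  rewrite [X in (_ <= _ * X)%E](_ : _ = +oo%E)//.
  by rewrite N0y addye ?addye ?nNy.
have [Hy|[mf1 [h h0 HE]]] := hom_sobolev_normVy f1.
  rewrite [X in (_ <= _ * X)%E](_ : _ = +oo%E)//.
  by rewrite Hy gt0_muley// addey ?addye ?nNy ?cvx_norm_ge0.
have [Ny|[n n_0 NE]] := cvx_norm_real f.
  rewrite [X in (_ <= _ * X)%E](_ : _ = +oo%E)//.
  by rewrite Ny gt0_muley// addey// nNy// adde_ge0 ?cvx_norm_ge0.
have N1le : (N f1 <= ka%:E * (N f + N f0))%E.
  apply: cvx_normD => //; apply: filterS ff => x ->.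
  by have := ler_normB (f0 x + f1 x) (f0 x); rewrite addrAC subrr add0r.
have [N1y|[n1 n10 N1E]] := cvx_norm_real f1.
  by move: N1le; rewrite N1y N0E NE -EFinD -EFinM leye_eq.
move: N1le; rewrite /sobolev_norm N0E HE NE N1E !lee_fin => N1le.
have := ler_wpM2l (ltW t0) N1le.
have : t * (ka * n0) <= ka * n0 by rewrite ler_piMl// mulr_ge0// ltW.
have : 0 <= ka * (t * h) by rewrite !mulr_ge0// ltW.
have : 0 <= t * n by rewrite mulr_ge0// ltW.
by lra.
Qed.

Lemma Kinh_le_Kmin : exists2 c : R, 0 < c & forall f t,
  L_plus_Linfty mu a f -> 0 < t ->
  (Kinh f t <= c%:E * (Khom f t + (Num.min 1 t)%:E * N f))%E.
Proof.
exists (1 + ka); first by rewrite addr_gt0.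
move=> f t Lf t0; have c0 : 0 < 1 + ka by rewrite addr_gt0.
have K0 : (0 <= Khom f t)%E.
  by apply: Kfun_ge0; [exact: ltW|exact: cvx_norm_ge0|exact: hom_sobolev_norm_ge0].
have [t1|t1] := leP t 1; last first.
  rewrite mul1e.
  apply: (@le_trans _ _ (N f)).
    have f0 : {ae mu, forall x, f x = f x + cst 0 x} by apply: aeW => x; rewrite addr0.
    rewrite (le_trans (Kfun_le _ _ t f0))// /sobolev_norm cvx_norm0 hom_sobolev_norm0.
    by rewrite adde0 mule0 adde0.
  apply: (@le_trans _ _ (Khom f t + N f)%E); first by rewrite leeDr.
  by rewrite lee_pemull ?adde_ge0 ?cvx_norm_ge0// lee_fin lerDl ltW.
have [->|[n n_0 NE]] := cvx_norm_real f.
  by rewrite gt0_muley// addey ?gt0_muley ?leey// gt_eqF// (lt_le_trans _ K0).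
rewrite -lee_pdivrMl// NE -EFinM -leeBlDr//; apply/ereal_infP => _ [p ff <-].
rewrite leeBlDr// lee_pdivrMl// EFinM -NE.
exact: Kinh_le_splitting.
Qed.

Lemma Kmin_le_Kinh : exists2 c : R, 0 < c & forall f t,
  L_plus_Linfty mu a f -> 0 < t ->
  (Khom f t + (Num.min 1 t)%:E * N f <= c%:E * Kinh f t)%E.
Proof.
exists (1 + ka); first by rewrite addr_gt0.
move=> f t Lf t0; have c0 : 0 < 1 + ka by rewrite addr_gt0.
have mf := L_plus_Linfty_measurable Lf.
rewrite -lee_pdivrMl//; apply/ereal_infP => _ [[f0 f1] /= ff <-].
rewrite lee_pdivrMl//.
have m0 : 0 <= Num.min 1 t by rewrite le_min ler01 ltW.
have m1 : Num.min 1 t <= 1 by rewrite ge_min lexx.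
have mt : Num.min 1 t <= t by rewrite ge_min lexx orbT.
apply: (@le_trans _ _ (N f0 + t%:E * H f1 +
    (Num.min 1 t)%:E * (ka%:E * (N f0 + N f1)))%E).
  apply: leeD; first exact: Kfun_le.
  apply: lee_wpmul2l; first by rewrite lee_fin.
  by apply: cvx_normD => //; apply: filterS ff => x ->; exact: ler_normD.
have ry (y : \bar R) : (y <= (1 + ka)%:E * +oo)%E by rewrite gt0_muley ?lte_fin ?leey.
have nNy (y : \bar R) : (0 <= y)%E -> y != -oo%E by case: y.
have tS0 : (0 <= t%:E * sobolev_norm X a f1)%E.
  rewrite mule_ge0 ?lee_fin ?(ltW t0)//.
  by rewrite adde_ge0 ?cvx_norm_ge0 ?hom_sobolev_norm_ge0.
have [N0y|[n0 n00 N0E]] := cvx_norm_real f0.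
  by rewrite [X in (_ <= _ * X)%E](_ : _ = +oo%E)// N0y addye ?nNy.
rewrite /sobolev_norm in tS0 *.
have [N1y|[n1 n10 N1E]] := cvx_norm_real f1.
  rewrite [X in (_ <= _ * X)%E](_ : _ = +oo%E)//.
  by rewrite N1y addye ?nNy ?hom_sobolev_norm_ge0// gt0_muley// addey ?nNy ?cvx_norm_ge0.
have [Hy|[_ [h h0 HE]]] := hom_sobolev_normVy f1.
  rewrite [X in (_ <= _ * X)%E](_ : _ = +oo%E)//.
  rewrite Hy [X in (t%:E * X)%E]addey; last exact/nNy/cvx_norm_ge0.
  by rewrite gt0_muley// addey//; exact/nNy/cvx_norm_ge0.
rewrite N0E N1E HE !lee_fin.
have : Num.min 1 t * (ka * n0) <= ka * n0 by rewrite ler_piMl// mulr_ge0// ltW.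
have : Num.min 1 t * (ka * n1) <= t * (ka * n1) by rewrite ler_wpM2r// mulr_ge0// ltW.
have : 0 <= t * n1 by rewrite mulr_ge0// ltW.
have : 0 <= ka * (t * h) by rewrite !mulr_ge0// ltW.
by lra.
Qed.

End inhomogeneous.

(** * Moduli of smoothness and K-functionals *)

Theorem theorem12 (d : measure_display) (R : realType) (T : borelMetricType d R)
    (mu : {measure set T -> \bar R})
    (mu_doubling : doubling mu)
    (mu_infinite : mu [set: T] = +oo%E)
    (mu_point : forall x : T, mu [set x] = 0%E)
    (X : ri_space mu) (a : R) (a_gt0 : 0 < a) (a_le1 : a <= 1) :
  let E := smoothness X a in
  let Khom := Kfun mu (cvx_norm X a) (hom_sobolev_norm X a) in
  let Kinh := Kfun mu (cvx_norm X a) (sobolev_norm X a) in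
  let dom := fun (f : T -> R) (t : R) => L_plus_Linfty mu a f /\ 0 < t in
  let Esum := fun (f : T -> R) (t : R) =>
    ((\sum_(0 <= j <oo)
       ((2 `^ (- (j%:R * a)))%:E * E f (2 ^+ j * t)%R `^ a)) `^ a^-1)%E in
  let Kmin := fun (f : T -> R) (t : R) =>
    (Khom f t + (Num.min 1 t)%:E * cvx_norm X a f)%E in
  [/\ preceq (fun f t => dom f t /\
        (cvx_set X a (nabla mu a t f) \/ majorization_closed X)) E Khom,
      preceq dom Khom Esum,
      preceq dom Kinh Kmin & preceq dom Kmin Kinh].
Proof.
have [x0 _] : [set: T] !=set0.
  by apply/set0P/eqP => T0; move: mu_infinite; rewrite T0 measure0.
split.
- have [c c0 H] := smoothness_le_K mu_doubling mu_point X a_gt0 a_le1.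
  by exists c => // f t [[Lf t0] nX]; exact: H.
- have [c c0 H] := K_le_smoothness_sum mu_doubling mu_point X a_gt0 a_le1 x0.
  by exists c => // f t [Lf t0]; exact: H.
- have [c c0 H] := Kinh_le_Kmin X a_gt0 a_le1.
  by exists c => // f t [Lf t0]; exact: H.
- have [c c0 H] := Kmin_le_Kinh X a_gt0 a_le1.
  by exists c => // f t [Lf t0]; exact: H.
Qed.
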